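(* For $b\in(3.06,3.062)$, $$\min_{z\in\mathbb{H}}\big(\zeta(6,z)-b\zeta(3,z)\big)=\min_{z\in\overline{\mathcal{D}_{\mathcal{G}}}}\big(\zeta(6,z)-b\zeta(3,z)\big)$$ and this minimum is achieved at $z=i$.
   Context: $\mathbb{H}=\{z: \Im z>0\}$. For $s>1$, $\zeta(s,z)=\sum_{(m,n)\in\mathbb{Z}^2\setminus\{0\}}\frac{(\Im z)^s}{|mz+n|^{2s}}$. $\mathcal{D}_{\mathcal{G}}=\{z\in\mathbb{H}: |z|>1,\ 0<\Re z<\frac12\}$. *)

(* Defs.v *)
From HB Require Import structures.
From mathcomp Require Import all_boot all_order all_algebra.
From mathcomp Require Import all_classical all_reals all_analysis.
Set Implicit Arguments. Unset Strict Implicit. Unset Printing Implicit Defensive.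
Import Order.TTheory GRing.Theory Num.Theory.
Import numFieldNormedType.Exports.
Local Open Scope classical_set_scope.
Local Open Scope ring_scope.

(* A point z = x + i y of the complex plane is represented by (x, y) : R * R. *)

Definition upper_half (R : realType) : set (R * R) := [set p | 0 < p.2].

Definition DG (R : realType) : set (R * R) :=
  [set p | 0 < p.2 /\ 1 < p.1 ^+ 2 + p.2 ^+ 2 /\ 0 < p.1 /\ p.1 < 2^-1].

(* |m z + n|^2 for z = x + i y. *)
Definition lat_norm2 (R : realType) (x y : R) (mn : int * int) : R :=
  (mn.1%:~R * x + mn.2%:~R) ^+ 2 + (mn.1%:~R * y) ^+ 2.

(* Epstein zeta function zeta(s, z) = sum_{(m,n) <> 0} (Im z)^s / |m z + n|^(2s),
   a sum of nonnegative terms taken as an extended-real unordered sum (esum);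
   for s > 1 and Im z > 0 it is finite, and we take its real value. *)
Definition zeta (R : realType) (s : R) (p : R * R) : R :=
  fine (\esum_(mn in [set mn : int * int | mn != (0%R, 0%R)])
          ((p.2 `^ s) / (lat_norm2 p.1 p.2 mn `^ s))%:E)%E.

Definition Fb (R : realType) (b : R) (p : R * R) : R :=
  zeta 6%:R p - b * zeta 3%:R p.

(* Main.v *)
Require Import Defs.
From HB Require Import structures.
From Stdlib Require Import ZArith.
From mathcomp Require Import all_boot all_order all_algebra.
From mathcomp Require Import all_classical all_reals all_analysis.
From mathcomp Require Import finmap ring lra zify ssrZ.
Import Order.TTheory GRing.Theory Num.Theory.
Import numFieldNormedType.Exports.
Local Open Scope classical_set_scope.
Local Open Scope ring_scope.

(* Write [z = x + i y] and [|m z + n|^2 / y = T (m^2 + n^2) + D (m^2 - n^2) + 2 h m n]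
   with [T^2 = 1 + D^2 + h^2]; then [zeta(s, z)] is the sum of the [-s]-th powers of these
   values, and [z = i] is the point [T = 1].  Averaging the terms over the dihedral
   symmetries of the lattice [Z^2] leaves functions of [T], [u = D^2], [v = h^2]: with
   [r = m^2 + n^2], the average for [s = 3] is at most [r^-3 T (4 T^2 - 3)] and the average
   for [s = 6] is at least [r^-6 (1 - 3 (u + v))].  These crude bounds suffice for long
   vectors; the shortest vectors and their multiples are kept exactly, and the orbits of
   [(1, 2)] and [(1, 3)] get a sharper polynomial bound.  The result is a lower bound for
   [F(z) - F(i)] that is a rational function of [T, u, v] vanishing at [T = 1].  Its
   numerator divided by [T - 1] is strictly positive on the relevant compact region, which
   is certified by Horner lower bounds on a bisected box; it is affine in [b], so only the
   two end values of [b] are needed.  For [T >= 6/5] cruder estimates are enough.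
   The modular symmetries bring [z] to [0 <= x <= 1/2], [|z|^2 >= 99/100]: relaxing
   [|z| >= 1] makes the descent terminate, since every inversion multiplies [y] by more
   than [100/99]. *)

Set Implicit Arguments.
Unset Strict Implicit.

(** * Certified positivity of bivariate polynomials *)

Section PolyOps.
Variables (C : Type) (c0 : C) (cadd : C -> C -> C) (cmul : C -> C -> C).

(** Coefficients stay abstract: the operations are used over [Z] and again over [seq Z], so a
    polynomial in [X] and [Y] is a polynomial in [X] whose coefficients are polynomials in [Y]. *)
Fixpoint padd (p q : seq C) : seq C :=
  match p, q with
  | [::], _ => q
  | _, [::] => p
  | a :: p', b :: q' => cadd a b :: padd p' q'
  end.

Definition pscale (a : C) (p : seq C) : seq C := map (cmul a) p.

Fixpoint pmul (p q : seq C) : seq C :=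
  if p is a :: p' then padd (pscale a q) (c0 :: pmul p' q) else [::].

Fixpoint pshift (p : seq C) : seq C :=
  if p is a :: p' then
    let q := pshift p' in padd (a :: q) q
  else [::].

Variable zmul : Z -> C -> C.

(* The pair of [n^(size p - 1) p(X / n)] and [n^(size p)]. *)
Fixpoint pdilate (n : Z) (p : seq C) : seq C * Z :=
  if p is a :: p' then
    let: (q, k) := pdilate n p' in (zmul k a :: q, Z.mul n k)
  else ([::], Zpos xH).

Variable clb : C -> Z.

(* Horner lower bound on [0, 1]: a nonnegative tail only helps. *)
Fixpoint plb (p : seq C) : Z :=
  if p is a :: p' then Z.add (clb a) (Z.min 0 (plb p')) else Z0.

Variable cneg : C -> C.

(* Lowers the degree to [n] by a lower bound on [0, 1]: higher terms only contribute
   their negative parts, moved to degree [n]. *)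
Fixpoint ptrunc (n : nat) (p : seq C) : seq C :=
  match n, p with
  | _, [::] => [::]
  | 0%N, a :: p' => [:: cadd a (foldr (fun b s => cadd (cneg b) s) c0 p')]
  | m.+1, a :: p' => a :: ptrunc m p'
  end.

End PolyOps.

Section PolyEval.
Variable R : realDomainType.

(** Coefficients are binary integers so that [vm_compute] can run the certificate; [zr] reads them
    in [R]. *)
Definition zr (z : Z) : R := (int_of_Z z)%:~R.

Lemma zrD a b : zr (Z.add a b) = zr a + zr b.
Proof. by rewrite /zr -[Z.add a b]/(a + b)%R !rmorphD. Qed.

Lemma zrM a b : zr (Z.mul a b) = zr a * zr b.
Proof. by rewrite /zr -[Z.mul a b]/(a * b)%R !rmorphM. Qed.

Lemma zrN a : zr (Z.opp a) = - zr a.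
Proof. by rewrite /zr -[Z.opp a]/(- a)%R !rmorphN. Qed.

Lemma zr0 : zr Z0 = 0. Proof. by []. Qed.
Lemma zr1 : zr (Zpos xH) = 1. Proof. by []. Qed.

Lemma zr_ge0 a : Z.leb Z0 a -> 0 <= zr a.
Proof. by case: a => // p _; rewrite /zr /= ler0z. Qed.

Lemma zr_gt0 a : Z.ltb Z0 a -> 0 < zr a.
Proof.
by case: a => // p _; rewrite /zr /= ltr0z ltz_nat; apply/ssrnat.ltP/Pos2Nat.is_pos.
Qed.

Section Generic.
Variables (C : Type) (c0 : C) (cadd cmul : C -> C -> C) (zmul : Z -> C -> C).
Variables (clb : C -> Z) (ev : C -> R).
Hypothesis ev0 : ev c0 = 0.
Hypothesis evD : forall a b, ev (cadd a b) = ev a + ev b.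
Hypothesis evM : forall a b, ev (cmul a b) = ev a * ev b.
Hypothesis evZ : forall n a, ev (zmul n a) = zr n * ev a.
Hypothesis ev_lb : forall a, zr (clb a) <= ev a.

Fixpoint peval (p : seq C) (x : R) : R :=
  if p is a :: p' then ev a + x * peval p' x else 0.

Lemma pevalD p q x : peval (padd cadd p q) x = peval p x + peval q x.
Proof.
elim: p q => [|a p IH] [|b q] /=; rewrite ?add0r ?addr0 // evD IH; ring.
Qed.

Lemma peval_scale a p x : peval (pscale cmul a p) x = ev a * peval p x.
Proof. by elim: p => [|b p IH] /=; rewrite ?mulr0 // evM IH; ring. Qed.

Lemma pevalM p q x : peval (pmul c0 cadd cmul p q) x = peval p x * peval q x.
Proof.
elim: p => [|a p IH]; first by rewrite /= mul0r.
rewrite -[pmul _ _ _ (_ :: _) _]/(padd cadd (pscale cmul a q) (c0 :: pmul c0 cadd cmul p q)).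
by rewrite pevalD peval_scale /= ev0 IH; ring.
Qed.

Lemma peval_zscale n p x : peval (map (zmul n) p) x = zr n * peval p x.
Proof. by elim: p => [|b p IH] /=; rewrite ?mulr0 // evZ IH; ring. Qed.

Lemma peval_shift p x : peval (pshift cadd p) x = peval p (1 + x).
Proof.
elim: p => [//|a p IH].
rewrite -[pshift _ (_ :: _)]/(padd cadd (a :: pshift cadd p) (pshift cadd p)).
by rewrite pevalD /= IH; ring.
Qed.

Lemma pdilate_snd n p : zr (pdilate zmul n p).2 = zr n ^+ size p.
Proof.
by elim: p => [//|a p IH] /=; case: pdilate IH => q k /= IH; rewrite zrM IH exprS.
Qed.

Lemma peval_dilate n p x :
  zr n * peval (pdilate zmul n p).1 (zr n * x) = zr n ^+ size p * peval p x.
Proof.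
elim: p => [|a p IH] /=; first by rewrite !mulr0.
have := pdilate_snd n p; case: pdilate IH => q k /= IH.
rewrite evZ exprS => ->.
have -> : zr n * (zr n ^+ size p * ev a + zr n * x * peval q (zr n * x)) =
  zr n * (zr n ^+ size p * ev a) + zr n * x * (zr n * peval q (zr n * x)) by ring.
by rewrite IH; ring.
Qed.

Lemma peval_lb p x : 0 <= x -> x <= 1 -> zr (plb clb p) <= peval p x.
Proof.
move=> x0 x1; elim: p => [//|a p IH] /=.
rewrite zrD lerD //; have [h|h] := Z.min_spec 0 (plb clb p).
  by rewrite h.2 mulr_ge0 // (le_trans _ IH) // zr_ge0 //; apply/Z.leb_le/Z.lt_le_incl/h.1.
rewrite h.2; apply: le_trans (_ : x * zr (plb clb p) <= _); last by rewrite ler_wpM2l.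
have : 0 <= zr (Z.opp (plb clb p)).
  by apply: zr_ge0; apply/Z.leb_le/Z.opp_nonneg_nonpos/h.1.
rewrite zrN; nra.
Qed.

Variable cneg : C -> C.
Hypothesis ev_neg_le : forall a, ev (cneg a) <= ev a.
Hypothesis ev_neg_le0 : forall a, ev (cneg a) <= 0.

Lemma peval_trunc n p x : 0 <= x -> x <= 1 ->
  peval (ptrunc c0 cadd cneg n p) x <= peval p x.
Proof.
move=> x0 x1; elim: n p => [|n IH] [|a p] //=; last by rewrite lerD2l ler_wpM2l.
rewrite mulr0 addr0 evD lerD2l; set s := foldr _ _ _.
have [s0 sp] : ev s <= 0 /\ ev s <= peval p x.
  rewrite {}/s; elim: p => [|b p [s0 sp]] /=; first by rewrite ev0.
  move: (foldr _ _ _) s0 sp => s s0 sp; rewrite evD; split.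
    by rewrite -[leRHS]addr0 lerD.
  apply: lerD => //; apply: le_trans (_ : x * ev s <= _); last by rewrite ler_wpM2l.
  by rewrite ler_niMl.
by apply: le_trans (_ : x * ev s <= _); [rewrite ler_niMl | rewrite ler_wpM2l].
Qed.
End Generic.
End PolyEval.

Local Notation Z2 := (Zpos (xO xH)).

Definition poly1 := seq Z.
Definition poly2 := seq poly1.

Definition add1 : poly1 -> poly1 -> poly1 := padd Z.add.
Definition mul1 : poly1 -> poly1 -> poly1 := pmul Z0 Z.add Z.mul.
Definition scale1 (n : Z) : poly1 -> poly1 := map (Z.mul n).
Definition add2 : poly2 -> poly2 -> poly2 := padd add1.
Definition mul2 : poly2 -> poly2 -> poly2 := pmul [::] add1 mul1.
Definition scale2 (n : Z) : poly2 -> poly2 := map (scale1 n).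
Definition lb1 : poly1 -> Z := plb id.
Definition lb2 : poly2 -> Z := plb lb1.

Definition neg1 : poly1 -> poly1 := map (Z.min Z0).

Definition trunc2 (m n : nat) (p : poly2) : poly2 :=
  map (ptrunc Z0 Z.add (Z.min Z0) n) (ptrunc [::] add1 neg1 m p).

(** The two halves of the box in [X], each rescaled to [0, 1]; a positive power of 2 clears the
    denominators. *)
Definition split_outer (p : poly2) : poly2 * poly2 :=
  let q := (pdilate scale1 Z2 p).1 in (q, pshift add1 q).

(** With a common length, halving the inner variable multiplies every coefficient polynomial by the
    same power of 2. *)
Definition pad (n : nat) (p : poly1) : poly1 := p ++ nseq (n - size p) Z0.

Definition split_inner (p : poly2) : poly2 * poly2 :=
  let n := foldr (fun c k => maxn (size c) k) 0%N p in
  let q := map (fun c => (pdilate Z.mul Z2 (pad n c)).1) p in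
  (q, map (pshift Z.add) q).

(* The members of [ds] describe the region: a box where one of them is negative
   is discarded. *)
Fixpoint check_box (fuel : nat) (inner : bool) (p : poly2) (ds : seq poly2) : bool :=
  if Z.leb Z0 (lb2 p) then true
  else if has (fun d => Z.ltb Z0 (lb2 (scale2 (Zneg xH) d))) ds then true
  else if fuel is f.+1 then
    let split := if inner then split_inner else split_outer in
    let pp := split p in
    let dd := map split ds in
    if check_box f (~~ inner) pp.1 (map fst dd)
    then check_box f (~~ inner) pp.2 (map snd dd) else false
  else false.

Section CheckSound.
Variable R : realFieldType.
Local Notation zr := (@zr R).

Definition ev1 (p : poly1) (y : R) : R := peval zr p y.
Definition ev2 (p : poly2) (x y : R) : R := peval (ev1 ^~ y) p x.

Lemma ev1_add p q y : ev1 (add1 p q) y = ev1 p y + ev1 q y.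
Proof. exact/pevalD/zrD. Qed.

Lemma ev1_mul p q y : ev1 (mul1 p q) y = ev1 p y * ev1 q y.
Proof. by apply: pevalM => // a b; rewrite (zrD, zrM). Qed.

Lemma ev1_scale n p y : ev1 (scale1 n p) y = zr n * ev1 p y.
Proof. by apply: peval_zscale => a b; rewrite zrM. Qed.

Lemma ev1_lb p y : 0 <= y -> y <= 1 -> zr (lb1 p) <= ev1 p y.
Proof. exact: peval_lb. Qed.

Lemma ev2_add p q x y : ev2 (add2 p q) x y = ev2 p x y + ev2 q x y.
Proof. by apply: pevalD => a b; rewrite ev1_add. Qed.

Lemma ev2_mul p q x y : ev2 (mul2 p q) x y = ev2 p x y * ev2 q x y.
Proof. by apply: pevalM => // a b; rewrite (ev1_add, ev1_mul). Qed.

Lemma ev2_scale n p x y : ev2 (scale2 n p) x y = zr n * ev2 p x y.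
Proof. by apply: peval_zscale => a b; rewrite ev1_scale. Qed.

Lemma ev2_lb p x y : 0 <= x -> x <= 1 -> 0 <= y -> y <= 1 ->
  zr (lb2 p) <= ev2 p x y.
Proof. by move=> x0 x1 y0 y1; apply: peval_lb => // a; apply: ev1_lb. Qed.

Lemma zr_min_le a : zr (Z.min Z0 a) <= zr a /\ zr (Z.min Z0 a) <= 0.
Proof.
have [[h ->]|[h ->]] := Z.min_spec Z0 a; split => //.
  exact/zr_ge0/Z.leb_le/Z.lt_le_incl.
by rewrite -oppr_ge0 -zrN; exact/zr_ge0/Z.leb_le/Z.opp_nonneg_nonpos.
Qed.

Lemma ev1_neg_le p y : 0 <= y -> ev1 (neg1 p) y <= ev1 p y /\ ev1 (neg1 p) y <= 0.
Proof.
move=> y0; rewrite /ev1; elim: p => //= a p [IH1 IH2].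
have [m1 m2] := zr_min_le a; split; first by rewrite lerD ?ler_wpM2l.
by rewrite -[leRHS]addr0 lerD // mulr_ge0_le0.
Qed.

Lemma ev2_trunc m n p x y : 0 <= x -> x <= 1 -> 0 <= y -> y <= 1 ->
  ev2 (trunc2 m n p) x y <= ev2 p x y.
Proof.
move=> x0 x1 y0 y1.
apply: le_trans (_ : ev2 (ptrunc [::] add1 neg1 m p) x y <= _); last first.
  apply: peval_trunc => // [a b|a|a]; first exact: ev1_add.
    by have [] := ev1_neg_le a y0.
  by have [] := ev1_neg_le a y0.
rewrite /ev2 /trunc2; elim: (ptrunc _ _ _ _ _) => //= a q IH.
rewrite lerD ?ler_wpM2l //; apply: peval_trunc => // [|b|b].
- exact: zrD.
- by have [] := zr_min_le b.
- by have [] := zr_min_le b.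
Qed.

Lemma zr2 : zr Z2 = 2.
Proof. by []. Qed.

Lemma ev2_split_outer1 p : exists2 k, 0 < k &
  forall x y, ev2 (split_outer p).1 (2 * x) y = k * ev2 p x y.
Proof.
exists (2 ^+ size p / 2); first by rewrite divr_gt0 // exprn_gt0.
move=> x y; have /= := @peval_dilate R poly1 scale1 (ev1^~ y) _ Z2 p x.
rewrite zr2 -/(split_outer p).1 => H.
have {H}: 2 * ev2 (split_outer p).1 (2 * x) y = 2 ^+ size p * ev2 p x y.
  by apply: H => n a; rewrite ev1_scale.
by move: (_ ^+ _) (ev2 _ _ _) (ev2 _ _ _) => A B C; lra.
Qed.

Lemma ev2_split_outer2 p x y :
  ev2 (split_outer p).2 x y = ev2 (split_outer p).1 (1 + x) y.
Proof. by apply: peval_shift => a b; rewrite ev1_add. Qed.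

Lemma ev1_pad n p y : ev1 (pad n p) y = ev1 p y.
Proof.
rewrite /ev1 /pad; elim: p (n - size p)%N => [|a p IH] k /=; last by rewrite IH.
by elim: k => //= k ->; rewrite mulr0 addr0.
Qed.

Lemma ev2_split_inner1 p : exists2 k, 0 < k &
  forall x y, ev2 (split_inner p).1 x (2 * y) = k * ev2 p x y.
Proof.
rewrite /split_inner /=; set n := foldr _ _ _.
have : all (fun c => size c <= n)%N p.
  rewrite {}/n; elim: p => //= c p IH; rewrite leq_maxl /=.
  by apply: sub_all IH => d /leq_trans -> //; rewrite leq_maxr.
move: n => n Hn; exists (2 ^+ n / 2); first by rewrite divr_gt0 // exprn_gt0.
move=> x y; rewrite /ev2; elim: p Hn => [|c p IH] /=; first by rewrite mulr0.
case/andP=> Hc /IH ->; rewrite mulrDr; congr (_ + _); last by ring.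
have /= := @peval_dilate R Z Z.mul zr (@zrM R) Z2 (pad n c) y.
have -> : size (pad n c) = n by rewrite size_cat size_nseq subnKC.
rewrite zr2 -/(ev1 _ _) -/(ev1 (pad n c) y) ev1_pad /ev1.
by move: (_ ^+ _) (peval _ _ _) (peval _ _ _) => A B C; lra.
Qed.

Lemma ev2_split_inner2 p x y :
  ev2 (split_inner p).2 x y = ev2 (split_inner p).1 x (1 + y).
Proof.
rewrite /split_inner /=; elim: [seq _ | c <- p] => //= c q; rewrite /ev2 /= => ->.
by congr (_ + _); apply: peval_shift; exact: zrD.
Qed.

(** A discarded box contains no point of the region, since some [d] is negative on all of it.
    Otherwise the point lies in one of the halves, and restriction to it multiplies all values by
    positive factors, which keeps their signs. *)
Lemma check_box_sound fuel inner p ds : check_box fuel inner p ds ->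
  forall x y, 0 <= x -> x <= 1 -> 0 <= y -> y <= 1 ->
  (forall d, d \in ds -> 0 <= ev2 d x y) -> 0 <= ev2 p x y.
Proof.
elim: fuel inner p ds => [|f IH] inner p ds /=.
all: case: ifP => [Hp _ x y x0 x1 y0 y1 _|_].
1,3: by apply: le_trans (ev2_lb _ x0 x1 y0 y1); apply: zr_ge0.
all: case: ifP => [/hasP[d dds Hd] _ x y x0 x1 y0 y1 /(_ d dds)|_ //].
1,2: have := zr_gt0 R Hd; have := ev2_lb (scale2 (Zneg xH) d) x0 x1 y0 y1;
  rewrite ev2_scale; have -> : zr (Zneg xH) = -1 by [].
1,2: move: (zr _) (ev2 d x y) => A B; lra.
case: ifP => // H1 H2 x y x0 x1 y0 y1 Hd.
case: inner H1 H2 => /= H1 H2.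
- have [k k0 Ek] := ev2_split_inner1 p.
  suff : 0 <= k * ev2 p x y by rewrite pmulr_rge0.
  rewrite -Ek; have [y2|y2] := lerP (2 * y) 1.
    apply: (IH _ _ _ H1) => //; first by lra.
    move=> d; rewrite -map_comp => /mapP[d' /Hd Hd' ->] /=.
    by have [k' k'0 ->] := ev2_split_inner1 d'; rewrite mulr_ge0 // ltW.
  have -> : 2 * y = 1 + (2 * y - 1) by ring.
  rewrite -ev2_split_inner2; apply: (IH _ _ _ H2) => //; try lra.
  move=> d; rewrite -map_comp => /mapP[d' /Hd Hd' ->] /=.
  rewrite ev2_split_inner2 addrC subrK.
  by have [k' k'0 ->] := ev2_split_inner1 d'; rewrite mulr_ge0 // ltW.
- have [k k0 Ek] := ev2_split_outer1 p.
  suff : 0 <= k * ev2 p x y by rewrite pmulr_rge0.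
  rewrite -Ek; have [y2|y2] := lerP (2 * x) 1.
    apply: (IH _ _ _ H1) => //; first by lra.
    move=> d; rewrite -map_comp => /mapP[d' /Hd Hd' ->] /=.
    by have [k' k'0 ->] := ev2_split_outer1 d'; rewrite mulr_ge0 // ltW.
  have -> : 2 * x = 1 + (2 * x - 1) by ring.
  rewrite -ev2_split_outer2; apply: (IH _ _ _ H2) => //; try lra.
  move=> d; rewrite -map_comp => /mapP[d' /Hd Hd' ->] /=.
  rewrite ev2_split_outer2 addrC subrK.
  by have [k' k'0 ->] := ev2_split_outer1 d'; rewrite mulr_ge0 // ltW.
Qed.
End CheckSound.

(** * The gap polynomial *)

Definition pconst (n : nat) : poly2 := [:: [:: Z.of_nat n]].
Definition varX : poly2 := [:: [::]; [:: Zpos xH]].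
Definition varY : poly2 := [:: [:: Z0; Zpos xH]].
Definition opp2 (p : poly2) : poly2 := scale2 (Zneg xH) p.
Fixpoint exp2 (p : poly2) (n : nat) : poly2 :=
  if n is m.+1 then mul2 p (exp2 p m) else pconst 1.

Declare Scope poly2_scope.
Delimit Scope poly2_scope with P2.
Local Infix "+" := add2 : poly2_scope.
Local Infix "*" := mul2 : poly2_scope.
Local Notation "p - q" := (add2 p (opp2 q)) : poly2_scope.
Local Infix "^" := exp2 : poly2_scope.

Section Gap.
Local Open Scope poly2_scope.
Let T := pconst 1 + varX.
Let w := varX * (pconst 2 + varX).
Let u := varY * w.
Let v := (pconst 1 - varY) * w.
Let k := pconst 1 + v.
Let j := pconst 1 + u.

(* [25^3 * avg_bound (s / 25) (c / 25)], see below. *)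
Definition avg_poly (s c : nat) : poly2 :=
  let m1 := pconst s * u + pconst c * v in
  let x := pconst (4 * s * c) * (u * v) in
  let m2 := m1 ^ 2 + x in
  let m3 := m1 ^ 3 + pconst 3 * (m1 * x) in
  T * ((pconst 4 * T ^ 2 - pconst 3) * (pconst 25 ^ 3 - pconst 1875 * m1 + pconst 150 * m2)
       - pconst 1875 * m1 + pconst 225 * m2 - pconst 18 * m3).

(* The numerator of [gap6 - B / 1000 * gap3] (defined below) at [T = 1 + X],
   [u = Y (T^2 - 1)], [v = (1 - Y) (T^2 - 1)]. *)
Definition gap_poly (B : nat) : poly2 :=
  let Sn := pconst 2 * T * (pconst 4 * T ^ 2 - pconst 3 * k) in
  let Tn := pconst 2 * T * (pconst 4 * T ^ 2 - pconst 3 * j) in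
  let k3 := k ^ 3 in let j3 := j ^ 3 in let kj := (k3 * j3) ^ 2 in
  let z6 := pconst 100 ^ 2 * (pconst 64 * (Sn ^ 2 - pconst 2 * k3) * j3 ^ 2
                           + (Tn ^ 2 - pconst 2 * j3) * k3 ^ 2)
            - kj * (pconst 130 * pconst 100 ^ 2 + pconst 96 * pconst 26 * w) in
  let z3 := pconst 100 ^ 2 * pconst 25 ^ 3
              * (pconst 12 ^ 6 + pconst 6 ^ 6 + pconst 4 ^ 6 + pconst 3 ^ 6)
              * (pconst 8 * Sn * j3 + Tn * k3 - pconst 18 * k3 * j3) * (k3 * j3)
            + kj * pconst 4 * pconst 12 ^ 6
              * (pconst 650 * (avg_poly 16 9 - pconst 25 ^ 3)
                 + pconst 80 * (avg_poly 9 16 - pconst 25 ^ 3)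
                 + pconst 94 * pconst 25 ^ 3 * (T * (pconst 4 * T ^ 2 - pconst 3) - pconst 1)) in
  pconst 1000 * pconst 12 ^ 6 * pconst 25 ^ 3 * z6 - pconst 8 * pconst B * z3.

(* In the domain [99/50 h] is at most both [T + D] and [T - D], and
   [(T + D) (T - D) = 1 + v]; this yields the two constraints. *)
Definition dom_poly1 : poly2 :=
  pconst 25 * (pconst 1 + pconst 5 * v) ^ 2 - pconst 392 * T ^ 2 * v.
Definition dom_poly2 : poly2 := pconst 25 - pconst 73 * v.
End Gap.

(* Up to a positive factor, [p (X / 5, Y)]; the variable [X = T - 1] ranges over [0, 1/5]. *)
Definition unit_box (p : poly2) : poly2 := (pdilate scale1 (Zpos 5) p).1.

(** The coefficient of [X^0] must vanish, and [behead] divides by [X]. The quotient is lowered to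
    degree 9 in [X] and 5 in [Y] to keep the bisection, of depth at most 24, cheap. *)
Definition gap_check (B : nat) : bool :=
  let p := gap_poly B in
  if all (Z.eqb Z0) (head [::] p) then
    check_box 24 false (trunc2 9 5 (unit_box (behead p)))
      [:: unit_box dom_poly1; unit_box dom_poly2]
  else false.

Lemma gap_check3060 : gap_check 3060.
Proof. by vm_compute. Qed.
Lemma gap_check3062 : gap_check 3062.
Proof. by vm_compute. Qed.

Section GapReal.
Variable R : realFieldType.

Lemma zr_nat n : zr R (Z.of_nat n) = n%:R.
Proof. by rewrite /zr; case: n => //= n; rewrite SuccNat2Pos.id_succ. Qed.

Lemma ev2_pconst n (x y : R) : ev2 (pconst n) x y = n%:R.
Proof. by rewrite /ev2 /ev1 /= zr_nat !mulr0 !addr0. Qed.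

Lemma ev2_X (x y : R) : ev2 varX x y = x.
Proof. by rewrite /ev2 /ev1 /= zr1 !mulr0 !addr0 add0r mulr1. Qed.

Lemma ev2_Y (x y : R) : ev2 varY x y = y.
Proof. by rewrite /ev2 /ev1 /= zr0 zr1 !mulr0 !addr0 add0r mulr1. Qed.

Lemma ev2_opp p (x y : R) : ev2 (opp2 p) x y = - ev2 p x y.
Proof. by rewrite ev2_scale -[RHS]mulN1r. Qed.

Lemma ev2_exp p n (x y : R) : ev2 (exp2 p n) x y = ev2 p x y ^+ n.
Proof.
elim: n => [|n IH]; first exact: ev2_pconst.
by rewrite -[exp2 p n.+1]/(mul2 p (exp2 p n)) ev2_mul IH exprS.
Qed.

Definition ev2E := (ev2_add, ev2_mul, ev2_opp, ev2_exp, ev2_pconst, ev2_X, ev2_Y).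

Lemma ev2_unit_box p (x y : R) : exists2 k, 0 < k &
  ev2 (unit_box p) (5 * x) y = k * ev2 p x y.
Proof.
exists (5 ^+ size p / 5); first by rewrite divr_gt0 // exprn_gt0.
have H : 5 * ev2 (unit_box p) (5 * x) y = 5 ^+ size p * ev2 p x y.
  rewrite -[5]/(zr R (Zpos 5)).
  by apply: peval_dilate => n a; rewrite ev1_scale.
by move: H; move: (_ ^+ _) (ev2 _ _ _) (ev2 _ _ _) => A B C; lra.
Qed.

Lemma gap_check_sound B : gap_check B -> forall x y : R,
  0 <= x -> x <= 1 / 5 -> 0 <= y -> y <= 1 ->
  0 <= ev2 dom_poly1 x y -> 0 <= ev2 dom_poly2 x y -> 0 <= ev2 (gap_poly B) x y.
Proof.
rewrite /gap_check; move: (gap_poly B) dom_poly1 dom_poly2 => p q1 q2.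
case: p => [_ x y|c p]; first by [].
case: ifP => // Hc Hp x y x0 x1 y0 y1 d1 d2; rewrite [behead _]/= in Hp.
have c0 : ev1 c y = 0.
  rewrite /ev1; elim: c Hc {Hp} => //= -[|a|a] c IH //= /IH ->.
  by rewrite zr0 mulr0 addr0.
rewrite [ev2 _ _ _]/= /ev2 /= c0 add0r mulr_ge0 // -/(ev2 p x y).
have [k k0 E] := ev2_unit_box p x y.
suff : 0 <= k * ev2 p x y by rewrite pmulr_rge0.
rewrite -E.
have x50 : 0 <= 5 * x by rewrite mulr_ge0.
have x51 : 5 * x <= 1 by move: x1; clear; lra.
apply: le_trans (ev2_trunc 9 5 (unit_box p) x50 x51 y0 y1).
have C := @check_box_sound R _ _ _ _ Hp (5 * x) y x50 x51 y0 y1.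
apply: C.
move=> d; rewrite !inE => /orP[] /eqP ->.
  by have [k1 k10 ->] := ev2_unit_box q1 x y; rewrite mulr_ge0 // ltW.
by have [k1 k10 ->] := ev2_unit_box q2 x y; rewrite mulr_ge0 // ltW.
Qed.

(* [sum_cube T k] is [a^-3 + c^-3] when [a + c = 2 T] and [a c = k]. *)
Definition sum_cube (T k : R) : R := 2 * T * (4 * T ^+ 2 - 3 * k) / k ^+ 3.

(* Obtained from [(1 + d)^-3 <= 1 - 3 d + 6 d^2] by averaging over the two values
   [d = s u + c v -+ x] with [x^2 = 4 s c u v], see [avg_le_bound]. *)
Definition avg_bound (s c T u v : R) : R :=
  let m1 := s * u + c * v in
  let x := 4 * s * c * (u * v) in
  let m2 := m1 ^+ 2 + x in
  let m3 := m1 ^+ 3 + 3 * (m1 * x) in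
  T * ((4 * T ^+ 2 - 3) * (1 - 3 * m1 + 6 * m2) - 3 * m1 + 9 * m2 - 18 * m3).

(* [sum_cube T (1 + v)] collects the orbit of [(1, 0)], [sum_cube T (1 + u) / 8] that of
   [(1, 1)]; [26/10000] and [94/10000] bound the sums of [r^-6] and [r^-3] over the
   remaining vectors, where [r = m^2 + n^2]. *)
Definition gap6 (T u v : R) : R :=
  2 * (sum_cube T (1 + v) ^+ 2 - 2 / (1 + v) ^+ 3)
  + 2 * ((sum_cube T (1 + u) / 8) ^+ 2 - 2 / (64 * (1 + u) ^+ 3))
  - 65 / 16 - 3 * (26 / 10000) * (u + v).

(** The factor [1 + 1/64 + 1/729 + 1/4096] collects the multiples 1 to 4 of [(1, 0)] and [(1, 1)].
    The weights [13/200 = 8 (5^-3 + 20^-3)] and [1/125 = 8 * 10^-3] belong to the orbits of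
    [(1, 2)], [(2, 4)] and of [(1, 3)]. *)
Definition gap3 (T u v : R) : R :=
  2 * (1 + 1 / 64 + 1 / 729 + 1 / 4096)
    * (sum_cube T (1 + v) + sum_cube T (1 + u) / 8 - 9 / 4)
  + 13 / 200 * (avg_bound (16 / 25) (9 / 25) T u v - 1)
  + 1 / 125 * (avg_bound (9 / 25) (16 / 25) T u v - 1)
  + 94 / 10000 * (T * (4 * T ^+ 2 - 3) - 1).

Local Opaque add2 mul2 opp2 exp2 pconst varX varY.

Lemma ev2_gap_poly B (x y : R) (T := 1 + x) (u := y * (x * (2 + x)))
    (v := (1 - y) * (x * (2 + x))) : 0 <= u -> 0 <= v -> exists2 K, 0 < K &
  ev2 (gap_poly B) x y = K * (gap6 T u v - B%:R / 1000 * gap3 T u v).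
Proof.
move=> u0 v0.
pose k3 := (1 + v) ^+ 3; pose j3 := (1 + u) ^+ 3.
have k30 : 0 < k3 by rewrite exprn_gt0 // ltr_wpDr.
have j30 : 0 < j3 by rewrite exprn_gt0 // ltr_wpDr.
(* A common denominator: [12^6] serves the multiples 1 to 4, [25^3] the two values of [avg_bound],
   and [(k3 j3)^2] the squares of [sum_cube]. *)
exists (32 * 100 ^+ 2 * (1000 * 12 ^+ 6 * 25 ^+ 3) * (k3 * j3) ^+ 2).
  apply: mulr_gt0; last exact/exprn_gt0/mulr_gt0.
  by rewrite !pmulr_rgt0 ?exprn_gt0 ?ltr0n.
rewrite /gap_poly; cbv beta zeta.
have E s c : ev2 (avg_poly s c) x y =
    25 ^+ 3 * avg_bound (s%:R / 25) (c%:R / 25) T u v.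
  rewrite /avg_poly; cbv beta zeta; rewrite !ev2E -[1%:R]/(1 : R) -/T -/u -/v.
  by rewrite /avg_bound !natrM; field.
move: (avg_poly 16 9) (avg_poly 9 16) (E 16%N 9%N) (E 9%N 16%N) => p1 p2 E1 E2.
rewrite !ev2E E1 E2 -[1%:R]/(1 : R) -/T -/u -/v.
rewrite /gap6 /gap3 /sum_cube -/k3 -/j3.
have -> : u + v = x * (2 + x) by rewrite /u /v; ring.
have k3N : k3 != 0 by rewrite gt_eqF.
have j3N : j3 != 0 by rewrite gt_eqF.
move: (avg_bound _ _ _ _ _) (avg_bound _ _ _ _ _) => P1 P2.
move: (4 * T ^+ 2 - 3 * (1 + v)) (4 * T ^+ 2 - 3 * (1 + u)) => A A'.
clearbody k3 j3 T; move: B%:R => b; clear - k3N j3N.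
field.
by rewrite j3N k3N.
Qed.

(* Both gap functions vanish at [T = 1], so the polynomial is divisible by
   [x = T - 1]; with [u = y (T^2 - 1)] the quotient stays positive up to the corner. *)
Lemma gap_ge0 (b T u v : R) : u + v = T ^+ 2 - 1 -> 1 <= T -> T <= 6 / 5 ->
  0 <= u -> 0 <= v -> 392 * T ^+ 2 * v <= 25 * (1 + 5 * v) ^+ 2 -> 73 * v <= 25 ->
  306 / 100 <= b -> b <= 3062 / 1000 -> 0 <= gap6 T u v - b * gap3 T u v.
Proof.
move=> uv T1 T2 u0 v0 d1 d2 b1 b2.
have [x x0 ET] : exists2 x, 0 <= x & T = 1 + x by exists (T - 1); [lra|ring].
have Ew : u + v = x * (2 + x) by rewrite uv ET; ring.
have [y [y0 y1 Eu]] : exists y, [/\ 0 <= y, y <= 1 & u = y * (x * (2 + x))].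
  have : 0 <= x * (2 + x) by rewrite -Ew addr_ge0.
  rewrite le_eqVlt => /predU1P[w0|w0].
    (* At [T = 1] both [u] and [v] vanish, so any [y] would do. *)
    by exists 0; rewrite mul0r; split => //; lra.
  exists (u / (x * (2 + x))); split; last by rewrite divfK // gt_eqF.
    by rewrite divr_ge0 // ltW.
  by rewrite ler_pdivrMr // mul1r -Ew lerDl.
have Ev : v = (1 - y) * (x * (2 + x)) by rewrite mulrBl mul1r -Eu -Ew; ring.
have x5 : x <= 1 / 5 by move: T2; rewrite ET; clear; lra.
have P B : gap_check B -> 0 <= gap6 T u v - B%:R / 1000 * gap3 T u v.
  move=> /gap_check_sound/(_ _ _ x0 x5 y0 y1).
  have [||K K0 ->] := @ev2_gap_poly B x y; [by rewrite -Eu | by rewrite -Ev |].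
  rewrite -Eu -Ev -ET (pmulr_rge0 _ K0); apply.
    rewrite /dom_poly1; cbv beta zeta; rewrite !ev2E -[1%:R]/(1 : R) -Ev -ET.
    by move: d1; clear; lra.
  rewrite /dom_poly2; cbv beta zeta; rewrite !ev2E -[1%:R]/(1 : R) -Ev.
  by move: d2; clear; lra.
have := P _ gap_check3060; have := P _ gap_check3062; clear - b1 b2.
by move: (gap6 _ _ _) (gap3 _ _ _) => A Z; nra.
Qed.
End GapReal.

(** * Pointwise estimates *)

Section Pointwise.
Variable R : realFieldType.
Implicit Types T D h w d r x t : R.

(** The tangent at [t = 1] lies below the convex function [t^-6]; after clearing the denominator the
    difference is a square times a polynomial with positive coefficients. *)
Lemma bernoulli_inv6 t : 0 < t -> 7 - 6 * t <= t^-1 ^+ 6.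
Proof.
move=> t0; rewrite exprVn -div1r ler_pdivlMr ?exprn_gt0 //.
have -> : (7 - 6 * t) * t ^+ 6 = 1 - (1 - t) ^+ 2 *
  (1 + 2 * t + 3 * t ^+ 2 + 4 * t ^+ 3 + 5 * t ^+ 4 + 6 * t ^+ 5) by ring.
by rewrite gerBl mulr_ge0 ?sqr_ge0 // !addr_ge0 // ?mulr_ge0 ?exprn_ge0 // ltW.
Qed.

Lemma bernoulli_inv3 t : 0 < t -> 4 - 3 * t <= t^-1 ^+ 3.
Proof.
move=> t0; rewrite exprVn -div1r ler_pdivlMr ?exprn_gt0 //.
have -> : (4 - 3 * t) * t ^+ 3 = 1 - (1 - t) ^+ 2 * (1 + 2 * t + 3 * t ^+ 2) by ring.
by rewrite gerBl mulr_ge0 ?sqr_ge0 // !addr_ge0 // ?mulr_ge0 ?exprn_ge0 // ltW.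
Qed.

Lemma pair_sum3 T w d : T ^+ 2 - w ^+ 2 = 1 + d -> T + w != 0 -> T - w != 0 ->
  (T + w)^-1 ^+ 3 + (T - w)^-1 ^+ 3 = sum_cube T (1 + d).
Proof. by move=> <- Ha Hc; rewrite /sum_cube subr_sqr; field; rewrite Ha Hc. Qed.

(** The square of the sum of inverse cubes, less twice their product. *)
Lemma pair_sum6 T w d : T ^+ 2 - w ^+ 2 = 1 + d -> T + w != 0 -> T - w != 0 ->
  (T + w)^-1 ^+ 6 + (T - w)^-1 ^+ 6 = sum_cube T (1 + d) ^+ 2 - 2 / (1 + d) ^+ 3.
Proof.
move=> E Ha Hc; rewrite -(pair_sum3 E Ha Hc) -E subr_sqr.
by field; rewrite Ha Hc.
Qed.

(** The tangent of [x^-6] at [x = T] is used at both points: the terms in [w] cancel and leave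
    [2 T^-6]. The tangent of [t^-3], taken at [t = T^2], then bounds [T^-6]. *)
Lemma pair_sum6_lb T w : 0 < T - w -> 0 < T + w -> 0 < T ->
  2 * (4 - 3 * T ^+ 2) <= (T + w)^-1 ^+ 6 + (T - w)^-1 ^+ 6.
Proof.
move=> a0 c0 T0.
have T2 : 4 - 3 * T ^+ 2 <= T^-1 ^+ 6.
  by rewrite (le_trans (bernoulli_inv3 _)) ?exprn_gt0 // -exprVn -exprM.
have sc x : 0 < x -> T^-1 ^+ 6 * (7 - 6 * (x / T)) <= x^-1 ^+ 6.
  move=> x0; have -> : x^-1 ^+ 6 = T^-1 ^+ 6 * (x / T)^-1 ^+ 6.
    by rewrite -exprMn invf_div mulrA mulVf ?mul1r // gt_eqF.
  by rewrite ler_wpM2l ?exprn_ge0 ?invr_ge0 ?(ltW T0) // bernoulli_inv6 // divr_gt0.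
have E : T^-1 ^+ 6 * (7 - 6 * ((T + w) / T)) + T^-1 ^+ 6 * (7 - 6 * ((T - w) / T))
   = 2 * T^-1 ^+ 6 by field; rewrite gt_eqF.
have := sc _ a0; have := sc _ c0; clear sc; lra.
Qed.

Lemma inv_cube_bound d : 0 <= d -> ((1 + d) ^+ 3)^-1 <= 1 - 3 * d + 6 * d ^+ 2.
Proof.
move=> d0; rewrite -div1r ler_pdivrMr ?exprn_gt0 ?ltr_wpDr //.
have -> : (1 - 3 * d + 6 * d ^+ 2) * (1 + d) ^+ 3 =
  1 + d ^+ 3 * (10 + 15 * d + 6 * d ^+ 2) by ring.
by rewrite lerDl mulr_ge0 ?exprn_ge0 // !addr_ge0 // ?mulr_ge0 ?exprn_ge0.
Qed.

Lemma sum_cube_le T d : 0 <= T -> 0 <= d -> 1 + d <= T ^+ 2 ->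
  sum_cube T (1 + d) <= 2 * T * (4 * T ^+ 2 - 3 * (1 + d)) * (1 - 3 * d + 6 * d ^+ 2).
Proof.
move=> T0 d0 dT; rewrite /sum_cube ler_wpM2l ?inv_cube_bound //.
by rewrite !mulr_ge0 //; lra.
Qed.

Lemma sum_cube_le1 T d : 0 <= T -> 0 <= d -> 1 + d <= T ^+ 2 ->
  sum_cube T (1 + d) <= 2 * (T * (4 * T ^+ 2 - 3)).
Proof.
move=> T0 d0 dT; rewrite /sum_cube ler_pdivrMr ?exprn_gt0 ?ltr_wpDr //.
rewrite mulrA; apply: le_trans (_ : 2 * T * (4 * T ^+ 2 - 3) <= _).
  by rewrite ler_wpM2l ?mulr_ge0 //; lra.
have TT : 0 <= 2 * T * (4 * T ^+ 2 - 3) by rewrite !mulr_ge0 //; lra.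
by rewrite ler_peMr // exprn_ege1 // lerDl.
Qed.

Lemma avg_le_bound s c T u v x d1 d2 : 0 <= T -> 0 <= d1 -> 0 <= d2 ->
  1 + d1 <= T ^+ 2 -> 1 + d2 <= T ^+ 2 ->
  d1 = s * u + c * v - x -> d2 = s * u + c * v + x -> x ^+ 2 = 4 * s * c * (u * v) ->
  (sum_cube T (1 + d1) + sum_cube T (1 + d2)) / 4 <= avg_bound s c T u v.
Proof.
move=> T0 d10 d20 dT1 dT2 E1 E2 Ex.
have H1 := sum_cube_le T0 d10 dT1; have H2 := sum_cube_le T0 d20 dT2.
suff -> : avg_bound s c T u v =
  (2 * T * (4 * T ^+ 2 - 3 * (1 + d1)) * (1 - 3 * d1 + 6 * d1 ^+ 2) +
   2 * T * (4 * T ^+ 2 - 3 * (1 + d2)) * (1 - 3 * d2 + 6 * d2 ^+ 2)) / 4.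
  by apply: ler_wpM2r; [rewrite invr_ge0|apply: lerD].
by rewrite /avg_bound -Ex E1 E2; field.
Qed.

(** Here [S = sum_cube T (1 + v)] is at least [44/10]. The gap for exponent 6 grows like [2 S^2],
    whereas the one for exponent 3 is at most linear in [S]. *)
Lemma gap_ge0_far (b T u v : R) : u + v = T ^+ 2 - 1 -> 6 / 5 <= T ->
  0 <= u -> 0 <= v -> 392 * T ^+ 2 * v <= 25 * (1 + 5 * v) ^+ 2 -> 73 * v <= 25 ->
  306 / 100 <= b -> b <= 3062 / 1000 ->
  0 <= gap6 T u v - b * (2 * (1 + 1 / 64 + 1 / 729 + 1 / 4096)
    * (sum_cube T (1 + v) + sum_cube T (1 + u) / 8 - 9 / 4)
    + (13 / 200 + 1 / 125 + 94 / 10000) * (T * (4 * T ^+ 2 - 3) - 1)).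
Proof.
move=> uv T1 u0 v0 d1 d2 b1 b2; set E := T * (4 * T ^+ 2 - 3).
have T0 : 0 <= T by move: T1; clear; lra.
have T2 : 144 / 100 <= T ^+ 2 by move: T1; clear; nra.
have v1 : v <= 1 / 10.
  (* With [T^2 >= 36/25] the first constraint excludes an interval of [v] from about 0.099 to 0.404,
     and [73 v <= 25] excludes what lies above it. *)
  by rewrite leNgt; apply/negP => v1; move: d1 d2 T2 v1; clear; nra.
have S2E : sum_cube T (1 + u) / 8 <= E / 4.
  have : sum_cube T (1 + u) <= 2 * E by apply: sum_cube_le1 => //; move: uv v0; clear; lra.
  by move: (sum_cube _ _) E => X E; clear; lra.
(* The contribution of the orbit of [(1, 1)] to exponent 6 is simply dropped. *)
have S20 : 0 <= (sum_cube T (1 + u) / 8) ^+ 2 - 2 / (64 * (1 + u) ^+ 3).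
  have -> : (sum_cube T (1 + u) / 8) ^+ 2 - 2 / (64 * (1 + u) ^+ 3) =
     (2 * (T * (4 * T ^+ 2 - 3 * (1 + u))) ^+ 2 - (1 + u) ^+ 3) / (32 * (1 + u) ^+ 6).
    by rewrite /sum_cube; field; rewrite gt_eqF // ltr_wpDr.
  apply: divr_ge0; last by rewrite mulr_ge0 // exprn_ge0 // addr_ge0.
  rewrite subr_ge0 exprMn.
  have -> : 2 * (T ^+ 2 * (4 * T ^+ 2 - 3 * (1 + u)) ^+ 2) =
    T ^+ 2 * (2 * (4 * T ^+ 2 - 3 * (1 + u)) ^+ 2) by ring.
  rewrite exprS; apply: ler_pM; rewrite ?exprn_ge0 ?addr_ge0 //; first by move: uv v0; clear; lra.
  have T2u : 1 + u <= T ^+ 2 by move: uv v0; clear; lra.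
  move: (T ^+ 2) T2u u0; clear => t tu u0; nra.
have k3 : (1 + v) ^+ 3 <= 1331 / 1000.
  have -> : 1331 / 1000 = (11 / 10) ^+ 3 :> R by field.
  by apply: lerXn2r; rewrite ?nnegrE; move: v0 v1; clear; lra.
have SE : E <= 3 / 4 * sum_cube T (1 + v).
  rewrite /sum_cube /E [leRHS]mulrA ler_pdivlMr ?exprn_gt0 ?ltr_wpDr //.
  have E0 : 0 <= T * (4 * T ^+ 2 - 3) by rewrite mulr_ge0 //; move: T2; clear; lra.
  apply: le_trans (ler_wpM2l E0 k3) _.
  rewrite -subr_ge0; have -> : 3 / 4 * (2 * T * (4 * T ^+ 2 - 3 * (1 + v))) -
      T * (4 * T ^+ 2 - 3) * (1331 / 1000) =
    T * (3 / 2 * (4 * T ^+ 2 - 3 * (1 + v)) - 1331 / 1000 * (4 * T ^+ 2 - 3)) by field.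
  apply: (mulr_ge0 T0); move: T2 v1; clear.
  move: (T ^+ 2) => t t2 v1.
  lra.
have E3 : 33 / 10 <= E by rewrite /E; move: T1 T2; clear; nra.
have ET : T ^+ 2 - 1 <= E by rewrite /E; move: T1 T2; clear; nra.
have k30 : 0 < (1 + v) ^+ 3 by rewrite exprn_gt0 // ltr_wpDr.
have k3i : 2 / (1 + v) ^+ 3 <= 2.
  by rewrite ler_pdivrMr // ler_peMr // exprn_ege1 // lerDl.
rewrite /gap6; move: (sum_cube T (1 + v)) (sum_cube T (1 + u) / 8) S2E S20 SE k3i.
rewrite uv; move: (2 / (1 + v) ^+ 3) (2 / (64 * (1 + u) ^+ 3)) (T ^+ 2) ET.
move: E E3; clear - b1 b2 => E E3 k3 j3 t ET S S2 S2E S20 SE k3i.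
have S4 : 44 / 10 <= S by move: E3 SE; clear; lra.
have b0 : 0 <= b by move: b1; clear; lra.
have H : 2 * (1 + 1 / 64 + 1 / 729 + 1 / 4096) * (S + S2 - 9 / 4)
   + (13 / 200 + 1 / 125 + 94 / 10000) * (E - 1) <= 248 / 100 * S - 465 / 100.
  by move: S4 S2E SE; clear; lra.
have S0 : 0 <= 248 / 100 * S - 465 / 100 by move: S4; clear; lra.
have SS : 44 / 10 * S <= S ^+ 2.
  by rewrite expr2; apply: ler_wpM2r => //; move: S4; clear; lra.
have := le_trans (ler_wpM2l b0 H) (ler_wpM2r S0 b2).
move: S20 SS S4 k3i ET E3 SE; clear.
by move: (S ^+ 2) (S2 ^+ 2) (b * _) => X1 X2 X3; lra.
Qed.
End Pointwise.

(** * Sums over the lattice *)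

Section HasSum.
Variables (R : realType) (I : choiceType).
Implicit Types (f g : I -> R) (s t c : R) (B : seq I).

(** Nonnegative families with a finite total: their sums can be handled in [R] instead of the
    extended reals. *)
Definition has_sum f s :=
  (forall i, 0 <= f i) /\ \esum_(i in setT) (f i)%:E = s%:E.

Lemma has_sum_uniq f s t : has_sum f s -> has_sum f t -> s = t.
Proof. by move=> [_ fs] [_ ft]; apply: EFin_inj; rewrite -fs -ft. Qed.

Lemma has_sum_fine f s : has_sum f s -> fine (\esum_(i in setT) (f i)%:E) = s.
Proof. by move=> [_ ->]. Qed.

Lemma has_sum_le f g s t : has_sum f s -> has_sum g t -> (forall i, f i <= g i) -> s <= t.
Proof.
move=> [_ fs] [_ gt] fg; rewrite -lee_fin -fs -gt.
by apply: le_esum => i _; rewrite lee_fin.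
Qed.

Lemma has_sum_ge0 f s : has_sum f s -> 0 <= s.
Proof.
by move=> [f0 fs]; rewrite -lee_fin -fs; apply: esum_ge0 => i _; rewrite lee_fin.
Qed.

Lemma has_sum_ext f g s : has_sum f s -> (forall i, f i = g i) -> has_sum g s.
Proof.
move=> [f0 fs] fg; split; first by move=> i; rewrite -fg.
by rewrite -fs; apply: eq_esum => i _; rewrite fg.
Qed.

Lemma has_sum_bounded f s :
  (forall i, 0 <= f i) -> (forall B, uniq B -> \sum_(i <- B) f i <= s) ->
  exists2 t, has_sum f t & t <= s.
Proof.
move=> f0 fs.
have le : (\esum_(i in setT) (f i)%:E <= s%:E)%E.
  apply: ge_ereal_sup => _ [X [finX _] <-].
  rewrite fsbig_finite //= sumEFin lee_fin; exact/fs/fset_uniq.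
have ge : (0 <= \esum_(i in setT) (f i)%:E)%E by apply: esum_ge0 => i _; rewrite lee_fin.
exists (fine (\esum_(i in setT) (f i)%:E)).
  by split=> //; rewrite fineK // ge0_fin_numE // (le_lt_trans le) // ltry.
by rewrite -lee_fin fineK // ge0_fin_numE // (le_lt_trans le) // ltry.
Qed.

Lemma has_sum_partial f s B : has_sum f s -> uniq B -> \sum_(i <- B) f i <= s.
Proof.
move=> [f0 fs] uB; rewrite -lee_fin -fs; apply: esum_ge; exists [set` B].
  by split=> //; apply: finite_seq.
by rewrite -fsbig_seq // sumEFin.
Qed.

Lemma has_sum_dominated f g t :
  (forall i, 0 <= f i) -> (forall i, f i <= g i) -> has_sum g t -> exists s, has_sum f s.
Proof.
move=> f0 fg gt; have [|s fs _] := @has_sum_bounded f t f0; last by exists s.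
move=> B uB; apply: le_trans (has_sum_partial gt uB).
by apply: ler_sum.
Qed.

Lemma has_sumD f g s t : has_sum f s -> has_sum g t ->
  has_sum (fun i => f i + g i) (s + t).
Proof.
move=> [f0 fs] [g0 gt]; split; first by move=> i; rewrite addr_ge0.
rewrite EFinD -fs -gt -esumD //; by move=> i _; rewrite lee_fin.
Qed.

(** Partial sums only bound the new total above by [c * s]; for [c > 0] the same bound with factor
    [c^-1], applied to the scaled family, gives the converse. *)
Lemma has_sumZ f s c : 0 <= c -> has_sum f s -> has_sum (fun i => c * f i) (c * s).
Proof.
have le d h r : 0 <= d -> has_sum h r ->
    exists2 r', has_sum (fun i => d * h i) r' & r' <= d * r.
  move=> d0 hr; apply: has_sum_bounded => [i|B uB].
    by rewrite mulr_ge0 //; case: hr.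
  by rewrite -mulr_sumr ler_wpM2l // (has_sum_partial hr).
move=> c0 fs; have [t ct tle] := le _ _ _ c0 fs.
move: c0; rewrite le_eqVlt => /predU1P[c0|c0].
  suff -> : c * s = t by [].
  apply/le_anti; rewrite tle andbT -c0 mul0r; exact: has_sum_ge0 ct.
have [|r ctr rle] := le c^-1 _ _ _ ct; first by rewrite invr_ge0 ltW.
have : r = s.
  apply: has_sum_uniq fs; apply: has_sum_ext ctr _ => i.
  by rewrite mulKf // gt_eqF.
move=> rs; suff -> : c * s = t by [].
apply/le_anti; rewrite tle andbT.
by rewrite -ler_pdivlMl // -rs.
Qed.

Lemma has_sum_reindex f s (e : I -> I) : involutive e -> has_sum f s ->
  has_sum (f \o e) s.
Proof.
move=> eK [f0 fs]; split; first by move=> i; apply: f0.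
rewrite -fs [RHS](@reindex_esum _ _ _ setT setT e) //.
split=> //; first by move=> i j _ _; apply: inv_inj.
by move=> i _; exists (e i).
Qed.

(** The rest converges by domination; adding back the finite part on [B] identifies its total by
    uniqueness. *)
Lemma has_sum_off f s B : has_sum f s -> uniq B ->
  has_sum (fun i => if i \in B then 0 else f i) (s - \sum_(i <- B) f i).
Proof.
move=> fs uB; have f0 := fs.1.
have [|||t ft] := @has_sum_dominated (fun i => if i \in B then 0 else f i) f s.
- by move=> i; case: ifP.
- by move=> i; case: ifP.
- by [].
suff -> : s - \sum_(i <- B) f i = t by [].
apply/eqP; rewrite subr_eq addrC; apply/eqP.
apply: (@has_sum_uniq f) => //.
have onB : has_sum (fun i => if i \in B then f i else 0) (\sum_(i <- B) f i).
  split; first by move=> i; case: ifP.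
  have -> : \esum_(i in setT) (if i \in B then f i else 0)%:E =
            \esum_(i in [set` B]) (f i)%:E.
    rewrite [RHS]esum_mkcond; apply: eq_esum => i _.
    by rewrite mem_setE; case: ifP.
  rewrite esum_fset; first by rewrite -fsbig_seq // sumEFin.
    exact: finite_seq.
  by move=> i _; rewrite lee_fin.
apply: has_sum_ext (has_sumD onB ft) _ => i /=.
by case: ifP => _; rewrite ?addr0 ?add0r.
Qed.
End HasSum.

(** * Dihedral orbits and the lattice sum of [r^-3] *)

Definition orbit8 (m n : int) : seq (int * int) :=
  [:: (m, n); (m, - n); (- m, n); (- m, - n); (n, m); (n, - m); (- n, m); (- n, - m)].
Definition axis4 (k : int) : seq (int * int) := [:: (k, 0); (0, k); (- k, 0); (0, - k)].
Definition diag4 (k : int) : seq (int * int) := [:: (k, k); (k, - k); (- k, k); (- k, - k)].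

(** For [k > 0], the [8 k] vectors of sup norm [k], grouped into dihedral orbits. *)
Definition shell (k : nat) : seq (int * int) :=
  axis4 k ++ flatten [seq orbit8 k j | j : nat <- index_iota 1 k] ++ diag4 k.

Section Orbits.
Variable R : realType.
Implicit Types F : int * int -> R.

Definition dihedral F :=
  [/\ forall m n, F (- m, n) = F (m, n), forall m n, F (m, - n) = F (m, n)
    & forall m n, F (n, m) = F (m, n)].

Lemma sum_orbit8 F m n : dihedral F -> \sum_(v <- orbit8 m n) F v = 8 * F (m, n).
Proof.
move=> [Fl Fr Fs]; rewrite /orbit8 !big_cons big_nil !(Fl, Fr) !(Fs m n); ring.
Qed.

Lemma sum_axis4 F k : dihedral F -> \sum_(v <- axis4 k) F v = 4 * F (k, 0).
Proof.
move=> [Fl Fr Fs]; rewrite /axis4 !big_cons big_nil !(Fl, Fr) !(Fs k 0); ring.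
Qed.

Lemma sum_diag4 F k : dihedral F -> \sum_(v <- diag4 k) F v = 4 * F (k, k).
Proof. by move=> [Fl Fr Fs]; rewrite /diag4 !big_cons big_nil !(Fl, Fr); ring. Qed.

Definition sqnorm (v : int * int) : R := v.1%:~R ^+ 2 + v.2%:~R ^+ 2.

Lemma ler_sum_subseq (I : eqType) (f : I -> R) (B L : seq I) :
  (forall i, 0 <= f i) -> uniq B -> {subset B <= L} ->
  \sum_(i <- B) f i <= \sum_(i <- L) f i.
Proof.
move=> f0; elim: B L => [|b B IH] L /=; first by rewrite big_nil sumr_ge0.
case/andP=> bB uB BL; have bL : b \in L by apply: BL; rewrite mem_head.
rewrite big_cons (perm_big _ (perm_to_rem bL)) big_cons lerD2l IH // => i iB.
have : i \in L by apply: BL; rewrite inE iB orbT.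
rewrite (perm_mem (perm_to_rem bL)) inE => /predU1P[E|//].
by move: bB; rewrite -E iB.
Qed.

Lemma mem_shell (v : int * int) (k : nat) : k = maxn `|v.1|%N `|v.2|%N ->
  (0 < k)%N -> v \in shell k.
Proof.
have orb (x y : int) : (x, y) \in orbit8 `|x|%N `|y|%N.
  by case: x y => [x|x] [y|y]; rewrite ?NegzE !inE !xpair_eqE ?abszN ?absz_nat !eqxx ?orbT.
have orb' (x y : int) : (x, y) \in orbit8 `|y|%N `|x|%N.
  by case: x y => [x|x] [y|y]; rewrite ?NegzE !inE !xpair_eqE ?abszN ?absz_nat !eqxx ?orbT.
have axis (x : int) : ((x, 0) \in axis4 `|x|%N) && ((0, x) \in axis4 `|x|%N).
  by case: x => x; rewrite ?NegzE !inE !xpair_eqE ?abszN ?absz_nat !eqxx ?orbT.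
have diag (x y : int) : `|x|%N = `|y|%N -> (x, y) \in diag4 `|y|%N.
  case: x y => [x|x] [y|y]; rewrite ?NegzE ?abszN ?absz_nat => ->;
  by rewrite !inE !xpair_eqE !eqxx ?orbT.
case: v => x y /= -> k0; rewrite !mem_cat.
case: (ltngtP `|x|%N `|y|%N) => xy.
- have [/eqP|x0] := posnP `|x|%N.
    by rewrite absz_eq0 => /eqP ->; have /andP[_ ->] := axis y.
  apply/orP; right; apply/orP; left; apply/flatten_mapP.
  by exists `|x|%N; rewrite ?mem_index_iota ?x0.
- have [/eqP|y0] := posnP `|y|%N.
    by rewrite absz_eq0 => /eqP ->; have /andP[-> _] := axis x.
  apply/orP; right; apply/orP; left; apply/flatten_mapP.
  by exists `|y|%N; rewrite ?mem_index_iota ?y0.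
- by rewrite ?xy (diag _ _ xy) !orbT.
Qed.

(** Since [0^-1 = 0], the origin contributes nothing and sums may run over all of [Z^2]. *)
Definition inv_sqnorm3 (v : int * int) : R := (sqnorm v)^-1 ^+ 3.

Lemma dihedral_inv_sqnorm3 : dihedral inv_sqnorm3.
Proof.
by split=> m n; rewrite /inv_sqnorm3 /sqnorm /= ?rmorphN ?sqrrN // addrC.
Qed.

Lemma sqnorm_ge0 v : 0 <= sqnorm v.
Proof. by rewrite addr_ge0 ?sqr_ge0. Qed.

Lemma inv_sqnorm3_ge0 v : 0 <= inv_sqnorm3 v.
Proof. by rewrite exprn_ge0 // invr_ge0 sqnorm_ge0. Qed.

Definition shell_sum (k : nat) : R :=
  4 * k%:R^-1 ^+ 6 + \sum_(1 <= j < k) 8 * (k%:R ^+ 2 + j%:R ^+ 2)^-1 ^+ 3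
  + 2^-1 * k%:R^-1 ^+ 6.

Lemma sum_shell (k : nat) : \sum_(v <- shell k) inv_sqnorm3 v = shell_sum k.
Proof.
have D := dihedral_inv_sqnorm3.
rewrite /shell !big_cat /= sum_axis4 // sum_diag4 // big_flatten /= big_map.
rewrite /shell_sum -addrA; congr (_ + (_ + _)).
- by rewrite /inv_sqnorm3 /sqnorm /= expr0n addr0 -exprVn -exprM.
- by apply: eq_bigr => j _; rewrite sum_orbit8.
- rewrite /inv_sqnorm3 /sqnorm /= -[(k : int)%:~R]/(k%:R : R).
  have [->|k0] := eqVneq (k%:R : R) 0; first by rewrite expr0n addr0 invr0 !expr0n !mulr0.
  have -> : (k%:R : R) ^+ 2 + k%:R ^+ 2 = 2 * k%:R ^+ 2 by ring.
  by field.
Qed.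

(** Each of the [8 k] vectors of the shell has [r >= k^2]. *)
Lemma shell_sum_le (k : nat) : (0 < k)%N -> shell_sum k <= 8 * k%:R^-1 ^+ 5.
Proof.
move=> k0; have K : 0 < k%:R :> R by rewrite ltr0n.
have H : \sum_(1 <= j < k) 8 * (k%:R ^+ 2 + j%:R ^+ 2)^-1 ^+ 3 <=
    (k%:R - 1) * (8 * k%:R^-1 ^+ 6) :> R.
  have -> : k%:R - 1 = (k - 1)%:R :> R by rewrite natrB.
  rewrite [leRHS]mulr_natl -[leRHS]sumr_const_nat; apply: ler_sum => j _.
  rewrite ler_pM2l // -[6%N]/(2 * 3)%N exprM; apply: lerXn2r.
    by rewrite nnegrE invr_ge0 addr_ge0 ?sqr_ge0.
    by rewrite nnegrE exprn_ge0 // invr_ge0 ltW.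
  by rewrite exprVn lef_pV2 ?posrE ?exprn_gt0 ?ltr_wpDr ?sqr_ge0 ?exprn_gt0 // lerDl sqr_ge0.
have E : 8 * k%:R^-1 ^+ 5 = k%:R * (8 * k%:R^-1 ^+ 6) :> R by field; rewrite gt_eqF.
have P : 0 <= k%:R^-1 ^+ 6 :> R by rewrite exprn_ge0 // invr_ge0 ltW.
by rewrite /shell_sum E; move: H P; move: (\sum_(_ <= _ < _) _) (k%:R^-1 ^+ 6) => A C; nra.
Qed.

Lemma shell_sumE (k : nat) : shell_sum k =
  9 / 2 * (k ^ 2)%:R^-1 ^+ 3 + \sum_(1 <= j < k) 8 * (k ^ 2 + j ^ 2)%:R^-1 ^+ 3.
Proof.
have E : k%:R^-1 ^+ 6 = (k ^ 2)%:R^-1 ^+ 3 :> R by rewrite natrX -exprVn -exprM.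
rewrite /shell_sum E addrAC -mulrDl; congr (_ * _ + _); first by field.
by apply: eq_bigr => j _; rewrite natrD !natrX.
Qed.

(* The sum is [4.6589...]; the excess comes from the telescoping tail bound. *)
Definition gauss_sum_bound : R := (466 - 1 / 100) / 100.

(** Each of the six shells is rounded up; [2 * 6^-4] is the telescoping bound for all later
    shells. *)
Lemma shell_sums_small : \sum_(1 <= k < 7) shell_sum k + 2 * 6^-1 ^+ 4 <= gauss_sum_bound.
Proof.
have s1 : shell_sum 1 <= 9 / 2.
  have -> : shell_sum 1 = 9 / 2 * 1%:R^-1 ^+ 3.
    by rewrite shell_sumE big_geq // ?addr0.
  lra.
have s2 : shell_sum 2 <= (134 + 313 / 1000) / 1000.
  have -> : shell_sum 2 = 9 / 2 * 4^-1 ^+ 3 + (8 * 5^-1 ^+ 3).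
    by rewrite shell_sumE big_ltn // big_geq // ?addr0.
  lra.
have s3 : shell_sum 3 <= (17 + 815 / 1000) / 1000.
  have -> : shell_sum 3 = 9 / 2 * 9^-1 ^+ 3 +
      (8 * 10^-1 ^+ 3 + (8 * 13^-1 ^+ 3)).
    by rewrite shell_sumE big_ltn // big_ltn // big_geq // ?addr0.
  lra.
have s4 : shell_sum 4 <= (4 + 240 / 1000) / 1000.
  have -> : shell_sum 4 = 9 / 2 * 16^-1 ^+ 3 +
      (8 * 17^-1 ^+ 3 + (8 * 20^-1 ^+ 3 + (8 * 25^-1 ^+ 3))).
    by rewrite shell_sumE big_ltn // big_ltn // big_ltn // big_geq // ?addr0.
  lra.
have s5 : shell_sum 5 <= (1 + 392 / 1000) / 1000.
  have -> : shell_sum 5 = 9 / 2 * 25^-1 ^+ 3 +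
      (8 * 26^-1 ^+ 3 + (8 * 29^-1 ^+ 3 + (8 * 34^-1 ^+ 3 + (8 * 41^-1 ^+ 3)))).
    by rewrite shell_sumE big_ltn // big_ltn // big_ltn // big_ltn // big_geq // ?addr0.
  lra.
have s6 : shell_sum 6 <= (0 + 561 / 1000) / 1000.
  have -> : shell_sum 6 = 9 / 2 * 36^-1 ^+ 3 +
      (8 * 37^-1 ^+ 3 + (8 * 40^-1 ^+ 3 +
        (8 * 45^-1 ^+ 3 + (8 * 52^-1 ^+ 3 + (8 * 61^-1 ^+ 3))))).
    by rewrite shell_sumE big_ltn // big_ltn // big_ltn // big_ltn // big_ltn // big_geq // ?addr0.
  lra.
rewrite big_ltn // big_ltn // big_ltn // big_ltn // big_ltn // big_ltn // big_geq // addr0.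
move: s1 s2 s3 s4 s5 s6.
move: (shell_sum 1) (shell_sum 2) (shell_sum 3) (shell_sum 4) (shell_sum 5) (shell_sum 6).
by move=> a1 a2 a3 a4 a5 a6; rewrite /gauss_sum_bound; lra.
Qed.

Lemma shell_sums_le N : \sum_(1 <= k < N.+1) shell_sum k <= gauss_sum_bound.
Proof.
have pos k : 0 <= shell_sum k.
  rewrite /shell_sum !addr_ge0 ?mulr_ge0 ?exprn_ge0 ?invr_ge0 ?ler0n // ?invr_ge0 //.
  apply: sumr_ge0 => j _; rewrite mulr_ge0 // exprn_ge0 // invr_ge0.
have S6 := shell_sums_small.
(* The integral comparison in telescoping form: [-2 x^-4] is a primitive of [8 x^-5]. *)
have stepR (x : R) : 1 <= x -> 8 * (x + 1)^-1 ^+ 5 <= 2 * x^-1 ^+ 4 - 2 * (x + 1)^-1 ^+ 4.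
  move=> x1; have x0 : 0 < x by lra.
  rewrite -subr_ge0.
  have -> : 2 * x^-1 ^+ 4 - 2 * (x + 1)^-1 ^+ 4 - 8 * (x + 1)^-1 ^+ 5 =
    (20 * x ^+ 3 + 20 * x ^+ 2 + 10 * x + 2) / (x ^+ 4 * (x + 1) ^+ 5).
    by field; rewrite !gt_eqF // ltr_wpDr.
  apply: divr_ge0; last by rewrite mulr_ge0 // exprn_ge0 //; lra.
  by rewrite !addr_ge0 // mulr_ge0 ?exprn_ge0 // ltW.
have step k : (0 < k)%N -> 8 * k.+1%:R^-1 ^+ 5 <= 2 * k%:R^-1 ^+ 4 - 2 * k.+1%:R^-1 ^+ 4 :> R.
  by move=> k0; rewrite -[k.+1%:R]natr1 stepR // ler1n.
have tail m : \sum_(7 <= k < 7 + m) shell_sum k <= 2 * 6^-1 ^+ 4 - 2 * (6 + m)%:R^-1 ^+ 4.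
  elim: m => [|m IH]; first by rewrite big_geq // addn0 subrr.
  rewrite addnS big_nat_recr ?leq_addr //= addnS.
  have := lerD IH (shell_sum_le (ltn0Sn (6 + m))).
  move/le_trans; apply; have := step (6 + m)%N isT.
  move: ((6 + m).+1%:R^-1 ^+ 5 : R) ((6 + m).+1%:R^-1 ^+ 4 : R) ((6 + m)%:R^-1 ^+ 4 : R).
  by move=> a c d; lra.
have [N6|N6] := leqP 6 N.
  rewrite (@big_cat_nat _ _ _ 7) //=; apply: le_trans S6; rewrite lerD2l.
  rewrite -(subnKC (n := N.+1) (m := 7)) //; apply: le_trans (tail _) _.
  by rewrite gerBl mulr_ge0 // exprn_ge0 // invr_ge0.
apply: le_trans S6.
rewrite (@big_cat_nat _ _ _ N.+1 1 7) //; last exact: ltnW.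
rewrite -addrA lerDl addr_ge0 ?sumr_ge0 //.
Qed.

Lemma has_sum_inv_sqnorm3 :
  exists2 M, has_sum inv_sqnorm3 M & M <= gauss_sum_bound.
Proof.
apply: has_sum_bounded; first exact: inv_sqnorm3_ge0.
move=> B uB; pose N := \max_(v <- B) maxn `|v.1|%N `|v.2|%N.
apply: le_trans (shell_sums_le N).
(* The origin is added at no cost because [B] may contain it. *)
have -> : \sum_(1 <= k < N.+1) shell_sum k =
    \sum_(v <- (0, 0) :: flatten [seq shell k | k <- index_iota 1 N.+1]) inv_sqnorm3 v.
  rewrite big_cons big_flatten /= big_map {1}/inv_sqnorm3 /sqnorm /= expr0n addr0 invr0.
  by rewrite expr0n add0r; apply: eq_bigr => k _; rewrite sum_shell.
apply: ler_sum_subseq => //; first exact: inv_sqnorm3_ge0.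
move=> v vB; rewrite inE; have [|k0] := posnP (maxn `|v.1|%N `|v.2|%N).
  by case: v {vB} => x y /= H; apply/orP; left; rewrite xpair_eqE; lia.
apply/orP; right; apply/flatten_mapP; exists (maxn `|v.1|%N `|v.2|%N).
  by rewrite mem_index_iota k0 ltnS /N (big_rem v) //= leq_maxl.
exact: mem_shell.
Qed.
End Orbits.

Lemma sqnorm_ge1 (R : realType) (v : int * int) : v != (0, 0) -> 1 <= sqnorm R v.
Proof.
case: v => m n; rewrite xpair_eqE => mn.
by rewrite /sqnorm /= -!rmorphXn -rmorphD /= ler1z; nia.
Qed.

(** * Dihedral averages for a form of determinant 1 *)

Section Comparison.
Variables (R : realType) (T D h : R).
Hypothesis T0 : 0 < T.
Hypothesis TDh : T ^+ 2 = 1 + D ^+ 2 + h ^+ 2.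
Implicit Types (v : int * int).
Local Notation sqnorm := (sqnorm R).
Local Notation inv_sqnorm3 := (inv_sqnorm3 R).

Definition qform v : R :=
  T * (v.1%:~R ^+ 2 + v.2%:~R ^+ 2) + D * (v.1%:~R ^+ 2 - v.2%:~R ^+ 2)
  + h * (2 * v.1%:~R * v.2%:~R).

Definition qinv v : R := (qform v)^-1.

(** The dihedral group of order 8 modulo the central symmetry, under which powers of [qinv] are
    invariant; hence only four terms. *)
Definition dihedral_avg (f : int * int -> R) v : R :=
  (f (v.1, v.2) + f (v.1, - v.2) + f (v.2, v.1) + f (v.2, - v.1)) / 4.

(* If [w = (D p + h q) / r] is the deviation of [qform v / r] from [T], where
   [p = m^2 - n^2] and [q = 2 m n], then [T^2 - w^2 = 1 + tilt (-1) v]. *)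
Definition tilt (e : R) v : R :=
  ((D * (2 * v.1%:~R * v.2%:~R) + e * h * (v.1%:~R ^+ 2 - v.2%:~R ^+ 2)) / sqnorm v) ^+ 2.

Lemma tilt_ge0 e v : 0 <= tilt e v.
Proof. exact: sqr_ge0. Qed.

(** The quarter turn negates both [p = m^2 - n^2] and [q = 2 m n], hence the deviation [w]; a
    reflection negates only [q]. As [p^2 + q^2 = r^2], Lagrange's identity turns [D^2 + h^2 - w^2]
    into the square defining [tilt]. *)
Lemma qform_pairs v : v != (0, 0) -> exists w1 w2 : R,
  [/\ qform (v.1, v.2) = sqnorm v * (T + w1) /\ qform (v.2, - v.1) = sqnorm v * (T - w1),
      qform (v.1, - v.2) = sqnorm v * (T + w2) /\ qform (v.2, v.1) = sqnorm v * (T - w2),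
      T ^+ 2 - w1 ^+ 2 = 1 + tilt (-1) v & T ^+ 2 - w2 ^+ 2 = 1 + tilt 1 v].
Proof.
move=> /(sqnorm_ge1 R); rewrite /tilt /qform /sqnorm /= !rmorphN /=.
move: (v.1%:~R : R) (v.2%:~R : R) => m n r1.
have r0 : m ^+ 2 + n ^+ 2 != 0 by rewrite gt_eqF // (lt_le_trans _ r1).
exists ((D * (m ^+ 2 - n ^+ 2) + h * (2 * m * n)) / (m ^+ 2 + n ^+ 2)).
exists ((D * (m ^+ 2 - n ^+ 2) - h * (2 * m * n)) / (m ^+ 2 + n ^+ 2)).
by rewrite TDh; split; [split| split| | ]; field.
Qed.

Lemma pair_gt0 (w d : R) : T ^+ 2 - w ^+ 2 = 1 + d -> 0 <= d -> 0 < T - w /\ 0 < T + w.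
Proof.
move=> E d0; have : `|w| < T.
  rewrite -ltr_sqr ?nnegrE ?(ltW T0) // real_normK ?num_real //; lra.
by rewrite ltr_norml => /andP[]; split; lra.
Qed.

Lemma qform_gt0 v : v != (0, 0) -> 0 < qform v.
Proof.
move=> v0; have [w1 [w2 [[E _] _ P _]]] := qform_pairs v0.
have [_ w0] := pair_gt0 P (tilt_ge0 _ _).
have -> : qform v = qform (v.1, v.2) by case: v {v0 E P}.
by rewrite E mulr_gt0 // (lt_le_trans ltr01 (sqnorm_ge1 R v0)).
Qed.

Lemma qinv_ge0 v : 0 <= qinv v.
Proof.
rewrite invr_ge0; have [->|/qform_gt0/ltW//] := eqVneq v (0, 0).
by rewrite /qform /= !expr0n /= !(addr0, subr0, mulr0).
Qed.

Lemma avg3E v : v != (0, 0) -> dihedral_avg (fun v => qinv v ^+ 3) v =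
  inv_sqnorm3 v * ((sum_cube T (1 + tilt (-1) v) + sum_cube T (1 + tilt 1 v)) / 4).
Proof.
move=> v0; have [w1 [w2 [[E1 E2] [E3 E4] P1 P2]]] := qform_pairs v0.
have [a1 c1] := pair_gt0 P1 (tilt_ge0 _ _); have [a2 c2] := pair_gt0 P2 (tilt_ge0 _ _).
rewrite /dihedral_avg /qinv E1 E2 E3 E4 -(pair_sum3 P1) ?gt_eqF // -(pair_sum3 P2) ?gt_eqF //.
by rewrite /inv_sqnorm3 !invfM !exprMn; ring.
Qed.

Lemma avg6E v : v != (0, 0) -> dihedral_avg (fun v => qinv v ^+ 6) v =
  inv_sqnorm3 v ^+ 2 *
  ((sum_cube T (1 + tilt (-1) v) ^+ 2 - 2 / (1 + tilt (-1) v) ^+ 3 +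
   (sum_cube T (1 + tilt 1 v) ^+ 2 - 2 / (1 + tilt 1 v) ^+ 3)) / 4).
Proof.
move=> v0; have [w1 [w2 [[E1 E2] [E3 E4] P1 P2]]] := qform_pairs v0.
have [a1 c1] := pair_gt0 P1 (tilt_ge0 _ _); have [a2 c2] := pair_gt0 P2 (tilt_ge0 _ _).
rewrite /dihedral_avg /qinv E1 E2 E3 E4 -(pair_sum6 P1) ?gt_eqF // -(pair_sum6 P2) ?gt_eqF //.
by rewrite /inv_sqnorm3 !invfM !exprMn; ring.
Qed.

Lemma avg6_ge v : v != (0, 0) ->
  inv_sqnorm3 v ^+ 2 * (4 - 3 * T ^+ 2) <= dihedral_avg (fun v => qinv v ^+ 6) v.
Proof.
move=> v0; have [w1 [w2 [_ _ P1 P2]]] := qform_pairs v0.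
have [a1 c1] := pair_gt0 P1 (tilt_ge0 _ _); have [a2 c2] := pair_gt0 P2 (tilt_ge0 _ _).
have H1 := pair_sum6_lb a1 c1 T0; have H2 := pair_sum6_lb a2 c2 T0.
rewrite avg6E // -(pair_sum6 P1) ?gt_eqF // -(pair_sum6 P2) ?gt_eqF //.
rewrite ler_wpM2l ?sqr_ge0 // ler_pdivlMr //; apply: le_trans (lerD H1 H2) => //; lra.
Qed.

Lemma tilt_le v e : e = 1 \/ e = -1 -> v != (0, 0) -> 1 + tilt e v <= T ^+ 2.
Proof.
move=> ee v0; have [w1 [w2 [_ _ P1 P2]]] := qform_pairs v0.
by case: ee => ->; rewrite -?P1 -?P2 gerBl sqr_ge0.
Qed.

(* [cosh (3 t)] when [T = cosh t]. *)
Definition cosh3 : R := T * (4 * T ^+ 2 - 3).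

Lemma cosh3_ge1 : 1 <= cosh3.
Proof.
have T1 : 1 <= T ^+ 2 by rewrite TDh -addrA lerDl addr_ge0 ?sqr_ge0.
have : 1 <= T by rewrite -(ler_sqr (x := 1)) ?nnegrE ?expr1n // ltW.
by move: T1; rewrite /cosh3; nra.
Qed.

Lemma avg_tilt_le v : v != (0, 0) ->
  (sum_cube T (1 + tilt (-1) v) + sum_cube T (1 + tilt 1 v)) / 4 <= cosh3.
Proof.
move=> v0.
have H1 := sum_cube_le1 (ltW T0) (tilt_ge0 _ _) (tilt_le (or_intror erefl) v0).
have H2 := sum_cube_le1 (ltW T0) (tilt_ge0 _ _) (tilt_le (or_introl erefl) v0).
rewrite ler_pdivrMr //; apply: le_trans (lerD H1 H2) _; rewrite /cosh3; lra.
Qed.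

Lemma avg3_le v : dihedral_avg (fun v => qinv v ^+ 3) v <= cosh3 * inv_sqnorm3 v.
Proof.
have [->|v0] := eqVneq v (0, 0).
  rewrite /dihedral_avg /qinv /qform /inv_sqnorm3 /sqnorm /= oppr0 !expr0n /=.
  by rewrite !(addr0, subr0, mulr0, invr0) expr0n /= !addr0 mul0r mulr0.
by rewrite avg3E // mulrC ler_wpM2r ?inv_sqnorm3_ge0 // avg_tilt_le.
Qed.

Lemma dihedral_avgP f : (forall m n, f (- m, - n) = f (m, n)) -> dihedral (dihedral_avg f).
Proof.
move=> fN; have fN1 m n : f (- m, n) = f (m, - n) by rewrite -fN opprK.
split=> m n; rewrite /dihedral_avg /= ?fN1 ?opprK; congr (_ / _); ring.
Qed.

Lemma qinv_opp k m n : qinv (- m, - n) ^+ k = qinv (m, n) ^+ k.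
Proof. by rewrite /qinv /qform /= !rmorphN /=; congr (_^-1 ^+ _); ring. Qed.

Lemma has_sum_dihedral_avg f s : has_sum f s -> has_sum (dihedral_avg f) s.
Proof.
move=> fs; pose e1 (v : int * int) := (v.1, - v.2); pose e2 (v : int * int) := (v.2, v.1).
have e1K : involutive e1 by move=> [m n]; rewrite /e1 /= opprK.
have e2K : involutive e2 by move=> [m n].
have H1 := has_sum_reindex e1K fs.
(* The quarter turn is no involution, so its term is reached by composing the two involutions. *)
have H := has_sumZ (c := 4^-1) _
  (has_sumD (has_sumD (has_sumD fs H1) (has_sum_reindex e2K fs)) (has_sum_reindex e2K H1)).
have -> : s = 4^-1 * (s + s + s + s) by field.
apply: has_sum_ext (H _) _; first by rewrite invr_ge0.
by move=> [m n]; rewrite /dihedral_avg mulrC.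
Qed.

(** One term is at most four times the average, which gives domination by [r^-3]; in particular
    [qinv ^+ 3] is bounded, so [qinv ^+ 6] is dominated by a multiple of it. *)
Lemma has_sum_qinv : exists s3 s6,
  has_sum (fun v => qinv v ^+ 3) s3 /\ has_sum (fun v => qinv v ^+ 6) s6.
Proof.
have q0 k v : 0 <= qinv v ^+ k by rewrite exprn_ge0 // qinv_ge0.
have [M fM _] := has_sum_inv_sqnorm3 R.
have E1 := cosh3_ge1.
have q3 v : qinv v ^+ 3 <= 4 * cosh3 * inv_sqnorm3 v.
  rewrite -mulrA; apply: le_trans (ler_wpM2l _ (avg3_le v)) => //.
  rewrite /dihedral_avg mulrC divfK //.
  case: v => m n /=; rewrite -!addrA lerDl !addr_ge0 //.
have C0 : 0 <= 4 * cosh3 by lra.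
have [s3 H3] := has_sum_dominated (q0 3%N) q3 (has_sumZ C0 fM).
have q6 v : qinv v ^+ 6 <= 4 * cosh3 * qinv v ^+ 3.
  rewrite -[6%N]/(3 + 3)%N exprD ler_wpM2r //; apply: le_trans (q3 v) _.
  rewrite ler_piMr //; have [->|v0] := eqVneq v (0, 0).
    by rewrite /inv_sqnorm3 /sqnorm /= expr0n addr0 invr0 expr0n.
  rewrite exprn_ile1 ?invr_ge0 ?sqnorm_ge0 // invf_le1 ?sqnorm_ge1 //.
  by rewrite (lt_le_trans ltr01 (sqnorm_ge1 R v0)).
have [s6 H6] := has_sum_dominated (q0 6%N) q6 (has_sumZ C0 H3).
by exists s3, s6.
Qed.
End Comparison.

(** * The vectors treated individually: [short1] for exponent 6, [short4] for exponent 3 *)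

Definition short1 : seq (int * int) := axis4 1 ++ diag4 1.

Definition short4 : seq (int * int) :=
  axis4 1 ++ axis4 2 ++ axis4 3 ++ axis4 4 ++ diag4 1 ++ diag4 2 ++ diag4 3 ++ diag4 4
  ++ orbit8 1 2 ++ orbit8 2 4 ++ orbit8 1 3.

Section ShortVectors.
Variables (R : realType) (T D h : R).
Hypothesis T0 : 0 < T.
Hypothesis TDh : T ^+ 2 = 1 + D ^+ 2 + h ^+ 2.
Implicit Types (v : int * int).
Local Notation inv_sqnorm3 := (@inv_sqnorm3 R).
Local Notation avg3 := (dihedral_avg (fun v => qinv T D h v ^+ 3)).
Local Notation avg6 := (dihedral_avg (fun v => qinv T D h v ^+ 6)).

(** For [v != (0, 0)] this is [r^3] times the average of [qinv ^+ 3]. *)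
Definition tilt_mean v : R :=
  (sum_cube T (1 + tilt D h (-1) v) + sum_cube T (1 + tilt D h 1 v)) / 4.

Lemma sum_short4 (F : int * int -> R) : dihedral F -> \sum_(v <- short4) F v =
  4 * (F (1, 0) + F (2, 0) + F (3, 0) + F (4, 0)
       + F (1, 1) + F (2, 2) + F (3, 3) + F (4, 4))
  + 8 * (F (1, 2) + F (2, 4) + F (1, 3)).
Proof.
by move=> FD; rewrite /short4 !big_cat /= !sum_axis4 // !sum_diag4 // !sum_orbit8 //; ring.
Qed.

Lemma sum_short1 (F : int * int -> R) : dihedral F -> \sum_(v <- short1) F v =
  4 * (F (1, 0) + F (1, 1)).
Proof. by move=> FD; rewrite /short1 !big_cat /= sum_axis4 // sum_diag4 //; ring. Qed.

Lemma tilt_axis e (k : nat) : e ^+ 2 = 1 -> (0 < k)%N -> tilt D h e (k : int, 0) = h ^+ 2.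
Proof.
move=> e2 k0; rewrite /tilt /sqnorm /= -[(Posz k)%:~R]/(k%:R : R).
have : (k%:R : R) != 0 by rewrite pnatr_eq0 -lt0n.
move: (k%:R : R) => K K0; rewrite -[RHS]mul1r -e2; field; by rewrite K0.
Qed.

Lemma tilt_diag e (k : nat) : (0 < k)%N -> tilt D h e (k : int, k : int) = D ^+ 2.
Proof.
move=> k0; rewrite /tilt /sqnorm /= -[(Posz k)%:~R]/(k%:R : R).
have : (k%:R : R) != 0 by rewrite pnatr_eq0 -lt0n.
move: (k%:R : R) => K K0; have -> : K ^+ 2 + K ^+ 2 = 2 * K ^+ 2 by ring.
by field.
Qed.

Lemma inv_sqnorm3_axis (k : nat) : inv_sqnorm3 (k : int, 0) = k%:R^-1 ^+ 6.
Proof. by rewrite /inv_sqnorm3 /sqnorm /= expr0n addr0 -exprVn -exprM. Qed.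

Lemma inv_sqnorm3_diag (k : nat) : inv_sqnorm3 (k : int, k : int) = k%:R^-1 ^+ 6 / 8.
Proof.
rewrite /inv_sqnorm3 /sqnorm /= -[(Posz k)%:~R]/(k%:R : R).
have [->|K0] := eqVneq (k%:R : R) 0; first by rewrite expr0n addr0 invr0 !expr0n mul0r.
have -> : (k%:R : R) ^+ 2 + k%:R ^+ 2 = 2 * k%:R ^+ 2 by ring.
by field.
Qed.

Lemma avg3_axis (k : nat) : (0 < k)%N ->
  avg3 (k : int, 0) = k%:R^-1 ^+ 6 * (sum_cube T (1 + h ^+ 2) / 2).
Proof.
move=> k0; rewrite avg3E //; last by rewrite xpair_eqE; lia.
by rewrite inv_sqnorm3_axis !tilt_axis ?sqrrN ?expr1n //; move: (_^-1 ^+ 6) => A; field.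
Qed.

Lemma avg3_diag (k : nat) : (0 < k)%N ->
  avg3 (k : int, k : int) = k%:R^-1 ^+ 6 * (sum_cube T (1 + D ^+ 2) / 16).
Proof.
move=> k0; rewrite avg3E //; last by rewrite xpair_eqE; lia.
by rewrite inv_sqnorm3_diag !tilt_diag //; move: (_^-1 ^+ 6) => A; field.
Qed.

Lemma avg6_axis : avg6 (1, 0) =
  (sum_cube T (1 + h ^+ 2) ^+ 2 - 2 / (1 + h ^+ 2) ^+ 3) / 2.
Proof.
rewrite avg6E // (inv_sqnorm3_axis 1) !(tilt_axis (k := 1)) ?sqrrN ?expr1n //.
rewrite invr1 !expr1n mul1r; move: (_ - _) => X; by field.
Qed.

Lemma avg6_diag : avg6 (1, 1) =
  (sum_cube T (1 + D ^+ 2) ^+ 2 - 2 / (1 + D ^+ 2) ^+ 3) / 128.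
Proof.
rewrite avg6E // (inv_sqnorm3_diag 1) !(@tilt_diag _ 1) //.
rewrite invr1 !expr1n mul1r; move: (_ - _) => X; by field.
Qed.

Lemma tilt_mean_le v s c (x : R) : v != (0, 0) ->
  tilt D h (-1) v = s * D ^+ 2 + c * h ^+ 2 - x ->
  tilt D h 1 v = s * D ^+ 2 + c * h ^+ 2 + x ->
  x ^+ 2 = 4 * s * c * (D ^+ 2 * h ^+ 2) ->
  tilt_mean v <= avg_bound s c T (D ^+ 2) (h ^+ 2).
Proof.
move=> v0 E1 E2 Ex; apply: avg_le_bound E1 E2 Ex; rewrite ?tilt_ge0 ?(ltW T0) //.
- by apply: (tilt_le TDh) => //; right.
- by apply: (tilt_le TDh) => //; left.
Qed.

(** For [(1, 2)] the triple [(p, q, r)] is [(-3, 4, 5)], so the tilts are the squares of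
    [(4 D -+ 3 h) / 5]. *)
Lemma tilt_mean_12_le : tilt_mean (1, 2) <= avg_bound (16 / 25) (9 / 25) T (D ^+ 2) (h ^+ 2).
Proof.
apply: (@tilt_mean_le _ _ _ (- (24 / 25 * D * h))) => //;
  rewrite /tilt /sqnorm /= -?[(Posz 2)%:~R]/(2 : R); by field.
Qed.

(** Now [(p, q, r) = (-8, 6, 10)], which exchanges the two weights. *)
Lemma tilt_mean_13_le : tilt_mean (1, 3) <= avg_bound (9 / 25) (16 / 25) T (D ^+ 2) (h ^+ 2).
Proof.
apply: (@tilt_mean_le _ _ _ (- (24 / 25 * D * h))) => //;
  rewrite /tilt /sqnorm /= -?[(Posz 3)%:~R]/(3 : R); by field.
Qed.

Lemma avg3_12 : avg3 (1, 2) = tilt_mean (1, 2) / 125.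
Proof.
rewrite avg3E // -/(tilt_mean (1, 2)) mulrC; congr (_ * _).
by rewrite /inv_sqnorm3 /sqnorm /= -[(Posz 2)%:~R]/(2 : R); field.
Qed.

Lemma avg3_24 : avg3 (2, 4) = tilt_mean (1, 2) / 8000.
Proof.
rewrite avg3E //.
have E e : tilt D h e (2, 4) = tilt D h e (1, 2).
  by rewrite /tilt /sqnorm /= -[(Posz 2)%:~R]/(2 : R) -[(Posz 4)%:~R]/(4 : R); field.
rewrite !E -/(tilt_mean (1, 2)) mulrC; congr (_ * _).
by rewrite /inv_sqnorm3 /sqnorm /= -[(Posz 2)%:~R]/(2 : R) -[(Posz 4)%:~R]/(4 : R); field.
Qed.

Lemma avg3_13 : avg3 (1, 3) = tilt_mean (1, 3) / 1000.
Proof.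
rewrite avg3E // -/(tilt_mean (1, 3)) mulrC; congr (_ * _).
by rewrite /inv_sqnorm3 /sqnorm /= -[(Posz 3)%:~R]/(3 : R); field.
Qed.

Lemma inv_sqnorm3_mixed :
  [/\ inv_sqnorm3 (1, 2) = 1 / 125, inv_sqnorm3 (2, 4) = 1 / 8000
    & inv_sqnorm3 (1, 3) = 1 / 1000].
Proof.
split; rewrite /inv_sqnorm3 /sqnorm /= -?[(Posz 2)%:~R]/(2 : R)
  -?[(Posz 4)%:~R]/(4 : R) -?[(Posz 3)%:~R]/(3 : R); by field.
Qed.
End ShortVectors.

(** * Comparison of the two lattice sums *)

Section SumsGap.
Variables (R : realType).
Implicit Types (v : int * int) (T D h : R).
Local Notation inv_sqnorm3 := (@inv_sqnorm3 R).

Lemma sum_short4_inv_sqnorm3 : \sum_(v <- short4) inv_sqnorm3 v =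
  9 / 2 * (1 + 1 / 64 + 1 / 729 + 1 / 4096) + 13 / 200 + 1 / 125.
Proof.
have [E1 E2 E3] := inv_sqnorm3_mixed R.
rewrite sum_short4; last exact: dihedral_inv_sqnorm3.
rewrite E1 E2 E3 (inv_sqnorm3_axis _ 1) (inv_sqnorm3_axis _ 2) (inv_sqnorm3_axis _ 3).
rewrite (inv_sqnorm3_axis _ 4) (inv_sqnorm3_diag _ 1) (inv_sqnorm3_diag _ 2).
by rewrite (inv_sqnorm3_diag _ 3) (inv_sqnorm3_diag _ 4); field.
Qed.

Lemma sum_short1_inv_sqnorm3 k : \sum_(v <- short1) inv_sqnorm3 v ^+ k = 4 + 4 / 8 ^+ k.
Proof.
have [Fl Fr Fs] := dihedral_inv_sqnorm3 R.
rewrite (@sum_short1 R (fun v => inv_sqnorm3 v ^+ k)).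
  by rewrite (inv_sqnorm3_axis _ 1) (inv_sqnorm3_diag _ 1) invr1 !expr1n mul1r exprVn mulrDr mulr1.
by split => m n; rewrite ?Fl ?Fr // Fs.
Qed.

Lemma inv_sqnorm3_le64 v : v \notin short1 -> inv_sqnorm3 v <= 1 / 64.
Proof.
move=> vB; have [->|v0] := eqVneq v (0, 0).
  by rewrite /inv_sqnorm3 /sqnorm /= expr0n addr0 invr0 expr0n /= divr_ge0.
have v4 : 4 <= sqnorm R v.
  case: v vB v0 => m n; rewrite !inE !xpair_eqE /sqnorm /= => H1 H2.
  by rewrite -!rmorphXn -rmorphD /= (ler_int R 4); nia.
rewrite /inv_sqnorm3; have -> : 1 / 64 = 4^-1 ^+ 3 :> R by field.
apply: lerXn2r; rewrite ?nnegrE ?invr_ge0 ?sqnorm_ge0 //.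
by rewrite lef_pV2 ?posrE // (lt_le_trans _ v4).
Qed.

(** Outside [short1], [r^-6] is at most [r^-3 / 64], and there the sum of [r^-3] is [M - 9/2], at
    most 0.1599. *)
Lemma has_sum_inv_sqnorm3_sqr M : has_sum inv_sqnorm3 M -> M <= gauss_sum_bound R ->
  exists2 M6, has_sum (fun v => inv_sqnorm3 v ^+ 2) M6 & M6 - 65 / 16 <= 26 / 10000.
Proof.
move=> HM MB; have u1 : uniq short1 by [].
have f0 := inv_sqnorm3_ge0 R.
have f1 v : inv_sqnorm3 v ^+ 2 <= inv_sqnorm3 v.
  have [->|v0] := eqVneq v (0, 0).
    by rewrite /inv_sqnorm3 /sqnorm /= expr0n addr0 invr0 expr0n /= expr0n.
  rewrite expr2 ler_piMr // exprn_ile1 ?invr_ge0 ?sqnorm_ge0 //.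
  by rewrite invf_le1 ?sqnorm_ge1 // (lt_le_trans ltr01 (sqnorm_ge1 R v0)).
have [|M6 H6] := has_sum_dominated _ f1 HM; first by move=> v; rewrite sqr_ge0.
exists M6 => //.
have H3 := has_sumZ (c := 1 / 64) _ (has_sum_off HM u1).
have := has_sum_le (has_sum_off H6 u1) (H3 _); rewrite sum_short1_inv_sqnorm3.
under eq_bigr do rewrite -[inv_sqnorm3 _]expr1.
rewrite sum_short1_inv_sqnorm3 => H.
have : M6 - (4 + 4 / 8 ^+ 2) <= 1 / 64 * (M - (4 + 4 / 8 ^+ 1)).
  apply: H; first by rewrite divr_ge0.
  move=> v; case: ifPn => [_|vB]; first by rewrite mulr0.
  by rewrite expr2 ler_wpM2r // inv_sqnorm3_le64.
by move: MB; rewrite /gauss_sum_bound; lra.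
Qed.

Lemma sums_gap T D h M M6 s3 s6 b : 0 < T -> T ^+ 2 = 1 + D ^+ 2 + h ^+ 2 ->
  has_sum inv_sqnorm3 M -> M <= gauss_sum_bound R ->
  has_sum (fun v => inv_sqnorm3 v ^+ 2) M6 -> M6 - 65 / 16 <= 26 / 10000 ->
  has_sum (fun v => qinv T D h v ^+ 3) s3 -> has_sum (fun v => qinv T D h v ^+ 6) s6 ->
  392 * T ^+ 2 * h ^+ 2 <= 25 * (1 + 5 * h ^+ 2) ^+ 2 -> 73 * h ^+ 2 <= 25 ->
  306 / 100 <= b -> b <= 3062 / 1000 ->
  M6 - b * M <= s6 - b * s3.
Proof.
move=> T0 TDh HM MB H6 M6B H3 H6' d1 d2 b1 b2.
have u0 : 0 <= D ^+ 2 by apply: sqr_ge0.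
have v0 : 0 <= h ^+ 2 by apply: sqr_ge0.
have uv : D ^+ 2 + h ^+ 2 = T ^+ 2 - 1 by rewrite TDh; ring.
have f0 := inv_sqnorm3_ge0 R.
have E1 := cosh3_ge1 T0 TDh.
have A3 := has_sum_dihedral_avg H3; have A6 := has_sum_dihedral_avg H6'.
have D3 := dihedral_avgP (f := fun v => qinv T D h v ^+ 3) (qinv_opp T D h 3).
have D6 := dihedral_avgP (f := fun v => qinv T D h v ^+ 6) (qinv_opp T D h 6).
have uS1 : uniq short1 by []. have uS4 : uniq short4 by [].
set e5 := tilt_mean T D h (1, 2); set e10 := tilt_mean T D h (1, 3).
have up : s3 - M <= 2 * (1 + 1 / 64 + 1 / 729 + 1 / 4096)
    * (sum_cube T (1 + h ^+ 2) + sum_cube T (1 + D ^+ 2) / 8 - 9 / 4)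
  + 13 / 200 * (e5 - 1) + 1 / 125 * (e10 - 1) + 94 / 10000 * (cosh3 T - 1).
  have C0 : 0 <= cosh3 T by apply: le_trans E1.
  have := has_sum_le (has_sum_off A3 uS4) (has_sumZ C0 (has_sum_off HM uS4)).
  rewrite sum_short4_inv_sqnorm3 sum_short4 //.
  rewrite (avg3_axis T0 TDh (k := 1)) // (avg3_axis T0 TDh (k := 2)) //.
  rewrite (avg3_axis T0 TDh (k := 3)) // (avg3_axis T0 TDh (k := 4)) //.
  rewrite (avg3_diag T0 TDh (k := 1)) // (avg3_diag T0 TDh (k := 2)) //.
  rewrite (avg3_diag T0 TDh (k := 3)) // (avg3_diag T0 TDh (k := 4)) //.
  rewrite avg3_12 // avg3_24 // avg3_13 // -/e5 -/e10 => H.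
  set S := sum_cube T (1 + h ^+ 2) in H *; set S2 := sum_cube T (1 + D ^+ 2) in H *.
  have {}H : s3 - (4 * (1%:R^-1 ^+ 6 * (S / 2) + 2%:R^-1 ^+ 6 * (S / 2)
      + 3%:R^-1 ^+ 6 * (S / 2) + 4%:R^-1 ^+ 6 * (S / 2)
      + 1%:R^-1 ^+ 6 * (S2 / 16) + 2%:R^-1 ^+ 6 * (S2 / 16)
      + 3%:R^-1 ^+ 6 * (S2 / 16) + 4%:R^-1 ^+ 6 * (S2 / 16))
      + 8 * (e5 / 125 + e5 / 8000 + e10 / 1000)) <=
    cosh3 T * (M - (9 / 2 * (1 + 1 / 64 + 1 / 729 + 1 / 4096) + 13 / 200 + 1 / 125)).
    apply: H => v; case: ifPn => _; first by rewrite mulr0.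
    exact: avg3_le.
  (* The vectors outside [short4] carry at most [94/10000] of the sum [M]. *)
  have : (cosh3 T - 1) * (M - (9 / 2 * (1 + 1 / 64 + 1 / 729 + 1 / 4096) + 13 / 200 + 1 / 125))
     <= (cosh3 T - 1) * (94 / 10000).
    apply: ler_wpM2l; first by rewrite subr_ge0.
    by move: MB; rewrite /gauss_sum_bound; clear; lra.
  by move: H; move: (cosh3 T) => E; clearbody e5 e10 S S2; clear; lra.
have lo : gap6 T (D ^+ 2) (h ^+ 2) <= s6 - M6.
  have w0 : 0 <= 3 * (T ^+ 2 - 1) by rewrite mulr_ge0 // -uv addr_ge0.
  (* The factor [4 - 3 T^2] may be negative, so its bound is rearranged as
     [r^-6 <= avg + 3 (T^2 - 1) r^-6], with only nonnegative families. *)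
  have := has_sum_le (has_sum_off H6 uS1)
    (has_sumD (has_sum_off A6 uS1) (has_sumZ w0 (has_sum_off H6 uS1))).
  have -> : \sum_(v <- short1) inv_sqnorm3 v ^+ 2 = 65 / 16.
    by rewrite sum_short1_inv_sqnorm3; field.
  rewrite sum_short1 // (avg6_axis T0 TDh) (avg6_diag T0 TDh).
  rewrite /gap6; set S := sum_cube T (1 + h ^+ 2); set S2 := sum_cube T (1 + D ^+ 2).
  set k3 := (1 + h ^+ 2) ^+ 3; set j3 := (1 + D ^+ 2) ^+ 3 => H.
  have {}H : M6 - 65 / 16 <= s6 - 4 * ((S ^+ 2 - 2 / k3) / 2 + (S2 ^+ 2 - 2 / j3) / 128)
      + 3 * (T ^+ 2 - 1) * (M6 - 65 / 16).
    apply: H => v; case: ifPn => [_|vB]; first by rewrite mulr0 addr0.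
    have [->|v0'] := eqVneq v (0, 0).
      by rewrite /inv_sqnorm3 /sqnorm /= expr0n addr0 invr0 !expr0n /= mulr0 addr0
        /dihedral_avg divr_ge0 // !addr_ge0 // exprn_ge0 // qinv_ge0.
    have := avg6_ge T0 TDh v0'.
    by move: (inv_sqnorm3 v ^+ 2) (dihedral_avg _ _) (T ^+ 2) => X Y t; clear; lra.
  have : 3 * (T ^+ 2 - 1) * (M6 - 65 / 16) <= 3 * (T ^+ 2 - 1) * (26 / 10000).
    exact: ler_wpM2l.
  have -> : 2 / (64 * j3) = 2 / j3 / 64 by rewrite invfM; ring.
  have -> : (S2 / 8) ^+ 2 = S2 ^+ 2 / 64 by field.
  rewrite uv.
  move: H; move: (2 / k3) (2 / j3) (S ^+ 2) (S2 ^+ 2) (T ^+ 2) => k j X Y t; clear; lra.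
have T1 : 1 <= T.
  by rewrite -(ler_sqr (x := 1)) ?nnegrE ?expr1n ?(ltW T0) // TDh -addrA lerDl addr_ge0.
have b0 : 0 <= b by move: b1; clear; lra.
have [T2|T2] := lerP T (6 / 5).
  have G := gap_ge0 uv T1 T2 u0 v0 d1 d2 b1 b2.
  have Hup : s3 - M <= gap3 T (D ^+ 2) (h ^+ 2).
    apply: le_trans up _; rewrite /gap3 -/(cosh3 T).
    have := tilt_mean_12_le T0 TDh; have := tilt_mean_13_le T0 TDh; rewrite -/e5 -/e10.
    move: (avg_bound _ _ _ _ _) (avg_bound _ _ _ _ _) (_ * (_ - 9 / 4)).
    by clearbody e5 e10; move: (cosh3 T); clear => E m1 m2 m3; lra.
  have := ler_wpM2l b0 Hup; move: G lo.
  by move: (gap6 _ _ _) (gap3 _ _ _) => g6 g3; rewrite mulrBr; clear; lra.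
have G := gap_ge0_far uv (ltW T2) u0 v0 d1 d2 b1 b2.
have e5E : e5 <= cosh3 T by apply: avg_tilt_le.
have e10E : e10 <= cosh3 T by apply: avg_tilt_le.
have Hup : s3 - M <= 2 * (1 + 1 / 64 + 1 / 729 + 1 / 4096)
    * (sum_cube T (1 + h ^+ 2) + sum_cube T (1 + D ^+ 2) / 8 - 9 / 4)
    + (13 / 200 + 1 / 125 + 94 / 10000) * (cosh3 T - 1).
  apply: le_trans up _; move: (_ * (_ - 9 / 4)) e5E e10E.
  by clearbody e5 e10; move: (cosh3 T); clear => E m1; lra.
have := ler_wpM2l b0 Hup; move: G lo; rewrite -/(cosh3 T).
by move: (gap6 _ _ _) (_ + _ * (cosh3 T - 1)) => g6 g3; rewrite mulrBr; clear; lra.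
Qed.
End SumsGap.

(** * Modular symmetries and reduction *)

Section Zeta.
Variables (R : realType).
Implicit Types (v : int * int) (p : R * R) (x y b : R).

Definition zterm p v : R := p.2 / lat_norm2 p.1 p.2 v.

Lemma lat_norm2_ge0 x y v : 0 <= lat_norm2 x y v.
Proof. by rewrite addr_ge0 ?sqr_ge0. Qed.

Lemma zetaE (k : nat) p : (0 < k)%N -> 0 < p.2 ->
  zeta k%:R p = fine (\esum_(v in setT) (zterm p v ^+ k)%:E).
Proof.
move=> k0 p0; rewrite /zeta; congr fine; rewrite [LHS]esum_mkcond.
apply: eq_esum => v _; rewrite !powR_mulrn ?lat_norm2_ge0 ?ltW // /zterm expr_div_n.
case: ifPn => //; rewrite notin_setE /= => /negP; rewrite negbK => /eqP ->.
by rewrite /lat_norm2 /= !mul0r addr0 expr0n /= addr0 expr0n gtn_eqF // invr0 mulr0.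
Qed.

Lemma zeta_invol (k : nat) p p' (e : int * int -> int * int) :
  (0 < k)%N -> 0 < p.2 -> 0 < p'.2 -> involutive e ->
  (forall v, zterm p' v = zterm p (e v)) -> zeta k%:R p' = zeta k%:R p.
Proof.
move=> k0 p0 p0' eK E; rewrite !zetaE //; congr fine.
rewrite [RHS](@reindex_esum _ _ _ setT setT e) //.
  by apply: eq_esum => v _; rewrite E.
split=> //; first by move=> i j _ _; apply: inv_inj.
by move=> i _; exists (e i).
Qed.

Lemma Fb_invol b p p' (e : int * int -> int * int) :
  0 < p.2 -> 0 < p'.2 -> involutive e ->
  (forall v, zterm p' v = zterm p (e v)) -> Fb b p' = Fb b p.
Proof.
by move=> p0 p0' eK E; rewrite /Fb (zeta_invol (k := 6) isT p0 p0' eK E)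
  (zeta_invol (k := 3) isT p0 p0' eK E).
Qed.

Lemma Fb_opp b x y : 0 < y -> Fb b (- x, y) = Fb b (x, y).
Proof.
move=> y0; apply: (@Fb_invol _ _ _ (fun v => (- v.1, v.2))) => //.
  by move=> [m n]; rewrite /= opprK.
by move=> [m n]; rewrite /zterm /lat_norm2 /= rmorphN /=; congr (_ / _); ring.
Qed.

Lemma Fb_reflect b x y : 0 < y -> Fb b (1 - x, y) = Fb b (x, y).
Proof.
move=> y0; apply: (@Fb_invol _ _ _ (fun v => (- v.1, v.2 + v.1))) => //.
  by move=> [m n]; rewrite /= opprK addrK.
by move=> [m n]; rewrite /zterm /lat_norm2 /= rmorphN rmorphD /=; congr (_ / _); ring.
Qed.

(** The reflection of [z] in the unit circle, which exchanges [m] and [n]. *)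
Lemma Fb_inversion b x y : 0 < y ->
  Fb b (x / (x ^+ 2 + y ^+ 2), y / (x ^+ 2 + y ^+ 2)) = Fb b (x, y).
Proof.
move=> y0; have N0 : 0 < x ^+ 2 + y ^+ 2 by rewrite ltr_wpDl ?sqr_ge0 ?exprn_gt0.
apply: (@Fb_invol _ _ _ (fun v => (v.2, v.1))) => //; first by rewrite /= divr_gt0.
  by move=> [m n].
move=> [m n]; rewrite /zterm /lat_norm2 /=.
have NN : x ^+ 2 + y ^+ 2 != 0 by rewrite gt_eqF.
set N := x ^+ 2 + y ^+ 2 in NN *.
have -> : (m%:~R * (x / N) + n%:~R) ^+ 2 + (m%:~R * (y / N)) ^+ 2 =
  ((n%:~R * x + m%:~R) ^+ 2 + (n%:~R * y) ^+ 2) / N.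
  by rewrite /N; field.
by rewrite invfM invrK mulrACA mulVf // mulr1.
Qed.

(** A unit translation is the composition of the reflections [x -> -x] and [x -> 1 - x], each of
    which acts on the lattice by an involution. *)
Lemma Fb_shift b x y (n : nat) : 0 < y -> Fb b (x + n%:R, y) = Fb b (x, y).
Proof.
move=> y0; elim: n => [|n IH]; first by rewrite addr0.
rewrite -IH -[RHS](Fb_opp _ _ y0) -[RHS](Fb_reflect _ _ y0); congr (Fb b (_, y)).
by rewrite -natr1; ring.
Qed.

Lemma Fb_strip b x y : 0 < y ->
  exists x', [/\ 0 <= x', x' <= 1 / 2 & Fb b (x', y) = Fb b (x, y)].
Proof.
move=> y0; have [x0 [x00 x01 <-]] :
    exists x0, [/\ 0 <= x0, x0 < 1 & Fb b (x0, y) = Fb b (x, y)].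
  exists (x - (Num.floor x)%:~R); split.
  - by rewrite subr_ge0 ge_floor.
  - by rewrite ltrBlDl -intrD1 ?floorD1_gt // lt_succ_floor.
  - case: (Num.floor x) => n; first by rewrite -[LHS](Fb_shift _ _ n y0) subrK.
    by rewrite NegzE rmorphN opprK /= -[n.+1%:~R]/(n.+1%:R : R) (Fb_shift _ _ _ y0).
have [h|h] := lerP x0 (1 / 2); first by exists x0.
exists (1 - x0); rewrite (Fb_reflect _ _ y0); split=> [||//].
  by move: x01; clear; lra.
by move: h; clear; lra.
Qed.

Lemma Fb_min_near_domain b x y : 306 / 100 <= b -> b <= 3062 / 1000 ->
  0 < y -> 0 <= x -> x <= 1 / 2 -> 99 / 100 <= x ^+ 2 + y ^+ 2 ->
  Fb b (0, 1) <= Fb b (x, y).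
Proof.
move=> b1 b2 y0 x0 x1 N1.
(* Chosen so that [T + D = |z|^2 / y] and [T - D = 1 / y], the diagonal entries of the form. *)
pose T := (x ^+ 2 + y ^+ 2 + 1) / (2 * y).
pose D := (x ^+ 2 + y ^+ 2 - 1) / (2 * y).
pose h := x / y.
have yN : y != 0 by rewrite gt_eqF.
have T0 : 0 < T by rewrite divr_gt0 ?mulr_gt0 // ltr_wpDl // addr_ge0 ?sqr_ge0.
have TDh : T ^+ 2 = 1 + D ^+ 2 + h ^+ 2 by rewrite /T /D /h; field.
have [M HM MB] := has_sum_inv_sqnorm3 R.
have [M6 H6 M6B] := has_sum_inv_sqnorm3_sqr HM MB.
have [s3 [s6 [S3 S6]]] := has_sum_qinv T0 TDh.
have h0 : 0 <= h by rewrite divr_ge0 // ltW.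
have c0 : 2 * h <= T - D.
  rewrite -subr_ge0; have -> : T - D - 2 * h = (1 - 2 * x) / y by rewrite /T /D /h; field.
  by apply: (divr_ge0 _ (ltW y0)); move: x1; clear; lra.
have a0 : 99 / 100 * (T - D) <= T + D.
  rewrite -subr_ge0; have -> : T + D - 99 / 100 * (T - D) = (x ^+ 2 + y ^+ 2 - 99 / 100) / y.
    by rewrite /T /D; field.
  by apply: (divr_ge0 _ (ltW y0)); move: N1; clear; lra.
have E v : zterm (x, y) v = qinv T D h v.
  rewrite /zterm /qinv -[RHS]mul1r; have -> : qform T D h v = lat_norm2 x y v / y.
    by rewrite /qform /lat_norm2 /T /D /h; field.
  by rewrite invfM invrK mulrCA mul1r mulrC.
clearbody T D h.
have P0 : 0 <= (T + D - 99 / 50 * h) * (T - D - 99 / 50 * h).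
  by apply: mulr_ge0; move: a0 c0 h0; clear; lra.
have d1 : 392 * T ^+ 2 * h ^+ 2 <= 25 * (1 + 5 * h ^+ 2) ^+ 2.
  (* Expanding [P0] with [T^2 - D^2 = 1 + h^2] leaves [1 + (1 + (99/50)^2) h^2], and
     [1 + (99/50)^2 < 5]. Squaring gives the constraint, as [25 (396/100)^2 > 392]. *)
  have H : 396 / 100 * (T * h) <= 1 + 5 * h ^+ 2 by move: P0 TDh; clear; nra.
  have Th : 0 <= 396 / 100 * (T * h)
    by apply: (mulr_ge0 _ (mulr_ge0 (ltW T0) h0)); apply: divr_ge0; exact: ler0n.
  have H2 : (396 / 100 * (T * h)) ^+ 2 <= (1 + 5 * h ^+ 2) ^+ 2.
    by apply: lerXn2r; rewrite ?nnegrE // (le_trans Th H).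
  have -> : 392 * T ^+ 2 * h ^+ 2 = 392 * (T * h) ^+ 2 by ring.
  have := sqr_ge0 (T * h); move: H2; rewrite exprMn.
  by move: ((T * h) ^+ 2) ((1 + _) ^+ 2) => A C; clear; lra.
have d2 : 73 * h ^+ 2 <= 25.
  have : (99 / 50 * h) ^+ 2 <= (T + D) * (T - D).
    by rewrite expr2; apply: ler_pM; move: a0 c0 h0; clear; lra.
  by move: TDh; clear; nra.
have G := sums_gap T0 TDh HM MB H6 M6B S3 S6 d1 d2 b1 b2.
have E0 v : zterm (0, 1) v = (sqnorm R v)^-1.
  rewrite /zterm /lat_norm2 /sqnorm /= mul1r; congr (_^-1); ring.
rewrite /Fb !zetaE // (has_sum_fine (s := M6)); last first.
  by apply: has_sum_ext H6 _ => v; rewrite E0 /inv_sqnorm3 -exprM.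
rewrite (has_sum_fine (s := M)); last by apply: has_sum_ext HM _ => v; rewrite E0.
rewrite (has_sum_fine (s := s6)); last by apply: has_sum_ext S6 _ => v; rewrite E.
by rewrite (has_sum_fine (s := s3)) //; apply: has_sum_ext S3 _ => v; rewrite E.
Qed.

Lemma Fb_min b x y : 306 / 100 <= b -> b <= 3062 / 1000 -> 0 < y ->
  Fb b (0, 1) <= Fb b (x, y).
Proof.
move=> b1 b2.
(* Here [n] bounds the number of inversions still needed: each one divides [y] by [|z|^2 < 99/100],
   and [y >= 1] already puts [z] in the relaxed domain. *)
have H n : forall x y, 0 < y -> 1 <= y * (100 / 99) ^+ n -> Fb b (0, 1) <= Fb b (x, y).
  elim: n => [|n IH] {}x {}y y0 yn; have [x' [x0 x1 <-]] := Fb_strip b x y0.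
    apply: Fb_min_near_domain => //; rewrite expr0 mulr1 in yn.
    have : 0 <= x' ^+ 2 by apply: sqr_ge0.
    by move: yn; clear; nra.
  have [N1|N1] := lerP (99 / 100) (x' ^+ 2 + y ^+ 2); first exact: Fb_min_near_domain.
  have N0 : 0 < x' ^+ 2 + y ^+ 2 by rewrite ltr_wpDl ?sqr_ge0 ?exprn_gt0.
  rewrite -(Fb_inversion _ _ y0); apply: IH; first by rewrite divr_gt0.
  apply: le_trans yn _; rewrite exprS mulrA ler_wpM2r ?exprn_ge0 ?divr_ge0 //.
  rewrite ler_wpM2l ?(ltW y0) //; have -> : 100 / 99 = (99 / 100)^-1 :> R by field.
  by rewrite lef_pV2 ?posrE ?divr_gt0 // ltW.
move=> y0; have /archi_boundP : 0 <= 99 / y by rewrite (divr_ge0 (ler0n _ _) (ltW y0)).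
set n := Num.bound _ => yn; apply: (H n) => //.
(* Bernoulli's inequality makes [n > 99 / y] large enough. *)
have B (m : nat) : 1 + m%:R / 99 <= (100 / 99) ^+ m :> R.
  elim: m => [|m IH]; first by rewrite mul0r addr0.
  rewrite exprS -natr1; have : 0 <= m%:R :> R by [].
  move: IH; move: (m%:R : R) ((100 / 99) ^+ m : R) => a c; lra.
have : 1 <= y * (n%:R / 99).
  by move: yn; rewrite ltr_pdivrMr //; move: (n%:R : R) => a; rewrite [y * _]mulrC; lra.
move/le_trans; apply; rewrite ler_wpM2l ?(ltW y0) //.
by apply: le_trans (B n); rewrite lerDr.
Qed.

Lemma i_in_closure_DG : closure (@DG R) (0, 1).
Proof.
move=> B /nbhs_ballP[e /= e0 eB].
(* The points [t + i (1 + t)] tend to [i]; [t <= 1/4] keeps them in the domain and [t <= e / 2] in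
   the ball. *)
pose t := Num.min (e / 2) (1 / 4).
have t0 : 0 < t by rewrite lt_min !divr_gt0.
have te : t < e by rewrite gt_min; apply/orP; left; move: e0; clear; lra.
have t4 : t <= 1 / 4 by rewrite ge_min lexx orbT.
exists (t, 1 + t); split; last first.
  apply: eB; split; rewrite -ball_normE /ball_ /=.
    by rewrite sub0r normrN gtr0_norm.
  by rewrite opprD addNKr normrN gtr0_norm.
rewrite /DG /=; move: t0 t4; clearbody t; clear => t0 t4.
by split; [lra|split; [nra|split; lra]].
Qed.

(** On the domain [y >= 1/2], a closed condition that passes to the closure. *)
Lemma closure_DG_upper p : closure (@DG R) p -> 0 < p.2.
Proof.
move=> cp; have : closure [set q : R * R | 1 / 2 <= q.2] p.
  apply: closureS cp => q [q0 [q1 [q2 q3]]] /=.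
  by rewrite leNgt; apply/negP => q4; move: q0 q1 q2 q3 q4; clear; nra.
rewrite -(closure_id _).1 /=; first by lra.
apply: (@closed_comp _ _ (@snd R R) [set t : R | 1 / 2 <= t]); last exact: closed_ge.
by move=> q _; apply: cvg_snd.
Qed.
End Zeta.

Unset Implicit Arguments.

Theorem theorem5p2 (R : realType) (b : R) :
  306%:R / 100%:R < b -> b < 3062%:R / 1000%:R ->
  (* i = (0,1) minimizes F over H *)
  ((0, 1) \in @upper_half R /\ forall z, z \in @upper_half R -> Fb b (0, 1) <= Fb b z) /\
  (* i = (0,1) minimizes F over the closure of D_G *)
  ((0, 1) \in closure (@DG R) /\ forall z, z \in closure (@DG R) -> Fb b (0, 1) <= Fb b z).
Proof.
move=> b1 b2; have b1' := ltW b1; have b2' := ltW b2.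
split; split.
- exact/mem_set/ltr01.
- by move=> [x y] /set_mem /= y0; exact: Fb_min.
- exact/mem_set/i_in_closure_DG.
- by move=> [x y] /set_mem/closure_DG_upper y0; exact: Fb_min.
Qed.
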